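(* Let $M_1,\dots,M_N$ be Kobayashi hyperbolic complex manifolds with $\dim_{\mathbb{C}}M_j=n_j$. Let $M=M_1\times\dots\times M_N$ be the product manifold and let $n=\sum_{j=1}^N n_j=\dim_{\mathbb{C}}M$. Then $$\kappa_M=\frac{n_1+1}{n+1}\kappa_{M_1}\times\dots\times\frac{n_N+1}{n+1}\kappa_{M_N},$$ that is, for every $p=(p_1,\dots,p_N)\in M$ and all $v=(v_1,\dots,v_N)$, $w=(w_1,\dots,w_N)$ in $\mathbf{T}_pM=\bigoplus_{j}\mathbf{T}_{p_j}M_j$, $$\kappa_M(v,w)=\sum_{j=1}^N\frac{n_j+1}{n+1}\,\kappa_{M_j}(v_j,w_j).$$
   Context: Complex Binet-Legendre construction. Let $V$ be a complex vector space of dimension $n\geq 1$, $F$ a norm on $V$, and $\Omega_F=\{v\in V: F(v)<1\}$. On the complex dual $V^*=\mathrm{Hom}_{\mathbb{C}}(V,\mathbb{C})$ define the Hermitian inner product $$\mathfrak{g}_F^*(\theta,\phi)=\frac{n+1}{|\Omega_F|}\int_{\Omega_F}\theta(\eta)\overline{\phi(\eta)}\,d\eta,$$ where $d\eta$ is any Haar measure on $(V,+)$ and $|\Omega_F|$ is the measure of $\Omega_F$ (the result does not depend on the choice of Haar measure). $\mathfrak{g}_F:V\times V\to\mathbb{C}$ is the dual Hermitian inner product: for $v\in V$ let $\mu(v)\in V^*$ be the unique element with $\mathfrak{g}_F^*(\phi,\mu(v))=\phi(v)$ for all $\phi\in V^*$, and set $\mathfrak{g}_F(v,w)=\mathfrak{g}_F^*(\mu(w),\mu(v))$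 (linear in $v$, conjugate-linear in $w$). Kobayashi metrics. Let $M$ be a complex manifold, $\mathbf{T}_pM$ its holomorphic tangent space at $p$, $\Delta\subset\mathbb{C}$ the unit disc. The Kobayashi(-Royden) pseudometric is, for $v\in\mathbf{T}_pM$, $$k_M(v)=\inf\{1/\lambda : \lambda>0,\ \text{there is a holomorphic } f:\Delta\to M \text{ with } f(0)=p,\ f'(0)=\lambda v\}.$$ $M$ is Kobayashi hyperbolic if $k_M$ is locally bounded below by a positive constant: every point of $M$ has a neighbourhood $U$, with a continuous Hermitian norm $\|\cdot\|$ on the holomorphic tangent spaces at points of $U$, and a constant $C>0$ such that $k_M(v)\ge C\|v\|$ for all $q\in U$, $v\in\mathbf{T}_qM$. The Kobayashi-Busemann (pseudo)metric is, for $v\in\mathbf{T}_pM$, $\hat{k}_M(v)=\inf\{t>0: t^{-1}v\in\hat\Omega_{M,p}\}$, where $\hat\Omega_{M,p}$ is the convex hull of $\Omega_{M,p}=\{v\in\mathbf{T}_pM: k_M(v)<1\}$. When $M$ is Kobayashi hyperbolic, $\hat{k}_M$ restricts to a norm on each $\mathbf{T}_pM$, and the Hermitian metric $\kappa_M$ is defined by $\kappa_M(v,w)=\mathfrak{g}_{\hat{k}_M|_{\mathbf{T}_pM}}(v,w)$ for $p\in M$, $v,w\in\mathbf{T}_pM$. (A Hermitian metric here is an assignment of a positive definite Hermitian inner product to each $\mathbf{T}_pM$.) *)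

(* Defs.v *)
From HB Require Import structures.
From mathcomp Require Import all_boot all_order all_algebra.
From mathcomp Require Import all_classical all_reals all_analysis.
From mathcomp Require Import complex.

Set Implicit Arguments.
Unset Strict Implicit.
Unset Printing Implicit Defensive.

Import Order.TTheory GRing.Theory Num.Theory.
Import numFieldNormedType.Exports.
Local Open Scope classical_set_scope.
Local Open Scope complex_scope.
Local Open Scope ring_scope.

(* numFieldNormedType only equips abstract numeric fields with their topology,
   not the concrete type [complex R]. *)
HB.instance Definition _ (R : realType) := NormedModule.copy R[i] R[i]^o.

Section BinetLegendre.
Variables (R : realType) (n : nat).
Local Notation C := R[i].
Local Notation V := 'rV[C]_n.

Definition borel_space := g_sigma_algebraType (@open V).

Definition haar_measure (mu : {measure set borel_space -> \bar R}) : Prop :=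
  [/\ forall (v : V) (A : set borel_space), measurable A ->
        mu [set v + x | x in A] = mu A,
      forall K : set V, compact K -> (mu K < +oo)%E
    & forall U : set V, open U -> U !=set0 -> (0 < mu U)%E].

Variable mu : {measure set borel_space -> \bar R}.

Definition complex_integral (D : set V) (f : V -> C) : C :=
  Rintegral mu D (fun x => complex.Re (f x)) +i*
  Rintegral mu D (fun x => complex.Im (f x)).

Variable F : V -> R.

Definition unit_ball : set V := [set v | F v < 1].

Definition dual_binet_legendre (theta phi : 'Hom(V, C^o)) : C :=
  (n.+1%:R / fine (mu unit_ball))%:C *
  complex_integral unit_ball (fun eta => theta eta * (phi eta)^*%R).

(* The element m of the dual with g*(phi, m) = phi(v) for all phi. *)
Definition binet_legendre_riesz (v : V) : 'Hom(V, C^o) :=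
  xget 0 [set m | forall phi : 'Hom(V, C^o), dual_binet_legendre phi m = phi v].

Definition binet_legendre (v w : V) : C :=
  dual_binet_legendre (binet_legendre_riesz w) (binet_legendre_riesz v).

End BinetLegendre.

(* [cmap] is a homeomorphism of the open set [cdom] onto an open subset of C^n,
   with inverse [cinv]; the values of [cmap] and [cinv] elsewhere are junk. *)
Record chart (R : realType) (n : nat) (T : topologicalType) := Chart {
  cdom : set T;
  cmap : T -> 'rV[R[i]]_n;
  cinv : 'rV[R[i]]_n -> T;
  cdom_open : open cdom;
  cimage_open : open (cmap @` cdom);
  cmapK : forall x, cdom x -> cinv (cmap x) = x;
  cmap_continuous : forall x, cdom x -> {for x, continuous cmap};
  cinv_continuous : forall y, (cmap @` cdom) y -> {for y, continuous cinv} }.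

(* [differentiable] is over the field R[i]: it is complex differentiability.
   The distinguished charts [chart_at] serve to represent tangent vectors. *)
Record complexManifold (R : realType) (n : nat) := ComplexManifold {
  mspace :> topologicalType;
  atlas : set (chart R n mspace);
  chart_at : mspace -> chart R n mspace;
  chart_at_atlas : forall p, atlas (chart_at p);
  chart_at_dom : forall p, cdom (chart_at p) p;
  transition_holomorphic : forall phi psi, atlas phi -> atlas psi ->
    forall p, cdom phi p -> cdom psi p ->
    differentiable (cmap psi \o cinv phi) (cmap phi p);
  mspace_hausdorff : hausdorff_space mspace;
  mspace_second_countable : @second_countable mspace }.

(* A holomorphic tangent vector at p is given by its coordinates in the chart
   [chart_at p]; its coordinates in another chart are obtained by applying the
   differential of the transition map (see [tangent_of_chart]). *)
Definition tangent_space (R : realType) n (M : complexManifold R n) (p : M) :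
  normedModType R[i] := 'rV[R[i]]_n.

Section Kobayashi.
Variables (R : realType) (n : nat) (M : complexManifold R n).
Local Notation C := R[i].

(* The tangent vector at q whose coordinates in the chart phi are a. *)
Definition tangent_of_chart (phi : chart R n M) (q : M) (a : 'rV[C]_n) :
    tangent_space q :=
  'd (cmap (chart_at q) \o cinv phi) (cmap phi q) a.

(* Only the values of f on the unit disc matter. *)
Definition holomorphic_disc (f : C -> M) : Prop :=
  forall z : C, `|z| < 1 ->
    {for z, continuous f} /\
    forall phi, atlas phi -> cdom phi (f z) ->
      differentiable (cmap phi \o f : C -> 'rV[C]_n) z.

Definition kobayashi (p : M) (v : tangent_space p) : R :=
  inf [set lambda^-1 | lambda in [set lambda : R | 0 < lambda /\
    exists f : C -> M, [/\ holomorphic_disc f, f 0 = p &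
      derive1 (cmap (chart_at p) \o f : C -> tangent_space p) 0 =
        lambda%:C *: v]]].

(* The values h q for q outside U are irrelevant; continuity of the Hermitian
   norm on U is continuity of the coefficients of h in every chart. *)
Definition kobayashi_hyperbolic : Prop :=
  forall p : M, exists2 U : set M, nbhs p U &
  exists h : forall q : M, {dot (tangent_space q) for (@Num.conj C)},
  exists2 c : R, 0 < c &
    (forall phi, atlas phi -> forall a b : 'rV[C]_n,
      {within U `&` cdom phi, continuous (fun q =>
        h q (tangent_of_chart phi q a) (tangent_of_chart phi q b) : C)}) /\
    (forall q, U q -> forall v : tangent_space q,
      c * Num.sqrt (complex.Re (h q v v)) <= kobayashi v).

Definition kobayashi_indicatrix (p : M) : set (tangent_space p) :=
  [set v | kobayashi v < 1].

(* The weights of [convex_set] are the t in R[i] with 0 <= t <= 1, hence real: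
   [smallest convex_set A] is the usual (real) convex hull of A. *)
Definition kobayashi_busemann (p : M) (v : tangent_space p) : R :=
  inf [set t : R | 0 < t /\
    smallest (@convex_set _ (tangent_space p)) (@kobayashi_indicatrix p)
      ((t^-1)%:C *: v)].

(* The Hermitian metric kappa_M, computed with the Haar measure mu on T_pM. *)
Definition kappa (mu : {measure set (borel_space R n) -> \bar R})
    (p : M) (v w : tangent_space p) : C :=
  binet_legendre mu (@kobayashi_busemann p) v w.

End Kobayashi.

Section ProductTopology.
Variables (N : nat) (T : 'I_N -> topologicalType).

Lemma cvg_prod_topology (G : set_system (prod_topology T))
    (x : prod_topology T) : Filter G ->
  (forall j, (fun y : prod_topology T => y j) @ G --> x j) -> G --> x.
Proof.
move=> FG Gx; apply/cvg_sup => j A [_ [[B oB <-] Bx] BA].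
by apply: (@filterS _ G FG _ _ BA); apply: (Gx j); apply: open_nbhs_nbhs; split.
Qed.

Lemma box_open (A : forall j, set (T j)) : (forall j, open (A j)) ->
  open [set x : prod_topology T | forall j, A j (x j)].
Proof.
move=> oA; rewrite openE => x Ax.
suff : \forall y \near (x : prod_topology T), forall j, A j (y j) by [].
have FF : Filter (nbhs (x : prod_topology T)) by exact: nbhs_filter.
apply: (@filter_forall _ 'I_N
  (fun j (y : prod_topology T) => A j (y j)) _ FF) => j.
apply: (@proj_continuous _ T j x).
by apply: open_nbhs_nbhs; split => //; exact: Ax.
Qed.

Lemma box_nbhs (x : prod_topology T) (A : set (prod_topology T)) : nbhs x A ->
  exists2 U : forall j, set (T j), forall j, nbhs (x j) (U j) &
    [set y | forall j, U j (y j)] `<=` A.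
Proof.
set G := filter_from [set U : forall j, set (T j) | forall j, nbhs (x j) (U j)]
  (fun U => [set y : prod_topology T | forall j, U j (y j)]).
have FG : Filter G.
  apply: filter_from_filter; first by exists (fun=> setT) => j; exact: filterT.
  move=> U W Ux Wx; exists (fun j => U j `&` W j) => [j|y UWy].
    exact: filterI.
  by split=> j; have [] := UWy j.
suff : G --> x by move=> /[apply].
apply: cvg_prod_topology => j B xB.
exists (dfwith (fun=> setT) j B) => [i|y].
  by case: dfwithP => [|i' _] //; exact: filterT.
by move=> /(_ j); rewrite dfwithin.
Qed.

Lemma second_countable_prod : (forall j, @second_countable (T j)) ->
  @second_countable (prod_topology T).
Proof.
move=> T2; pose B j := sval (cid2 (T2 j)).
have cB j : countable (B j) by rewrite /B; case: cid2.
have bB j : basis (B j) by rewrite /B; case: cid2.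
have e_ j : {f : set (T j) -> nat | {in B j &, injective f}}.
  exact/cid/countable_injP.
pose e j := sval (e_ j); have eI j : {in B j &, injective (e j)} := svalP (e_ j).
have sB j x U : nbhs x U -> exists2 V, B j V /\ V x & V `<=` U.
  by move=> xU; have [_ /(_ x U xU)] := bB j; case=> V [BV Vx] VU; exists V.
pose D : set (forall j, set (T j)) := [set U | forall j, B j (U j)].
pose box (U : forall j, set (T j)) :=
  [set x : prod_topology T | forall j, U j (x j)].
exists (box @` D).
  apply: (sub_countable (card_image_le _ _)); apply/countable_injP.
  exists (fun U => pickle [ffun j => e j (U j)]) => U W /set_mem DU /set_mem DW.
  move=> /(pcan_inj pickleK)/ffunP eUW; apply: functional_extensionality_dep.
  by move=> j; apply: eI; rewrite ?inE//; have := eUW j; rewrite !ffunE.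
split=> [_ [U DU <-]|x A].
  by apply: box_open => j; have [oB _] := bB j; exact/oB/DU.
move=> /box_nbhs[U xU UA].
have V_ j : {V | [/\ B j V, V (x j) & V `<=` U j]}.
  by apply/cid; have [V []] := sB j _ _ (xU j); exists V.
pose V j := sval (V_ j).
have VP j : [/\ B j (V j), V j (x j) & V j `<=` U j] := svalP (V_ j).
exists (box V).
  by split=> [|j]; [exists V => // j|]; have [] := VP j.
by move=> y Vy; apply: UA => j; have [_ _] := VP j; apply; exact: Vy.
Qed.

End ProductTopology.

Section BlockRows.
Variables (R : realType) (N : nat) (n : 'I_N -> nat).
Local Notation C := R[i].
Local Notation V := 'rV[C]_(\sum_j n j).

Lemma mulmxr_continuous m p (B : 'M[C]_(m, p)) :
  continuous (mulmxr B : 'rV[C]_m -> 'rV[C]_p).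
Proof.
move=> A U [P AP PU].
have FF : Filter (nbhs A) by exact: nbhs_filter.
suff AP' : \forall M \near A, forall i j, P i j ((M *m B) i j).
  by apply: (@filterS _ _ FF _ _ _ AP') => M PM; apply: PU.
apply: (@filter_forall _ _
  (fun i (M : 'rV[C]_m) => forall j, P i j ((M *m B) i j)) _ FF) => i.
apply: (@filter_forall _ _
  (fun j (M : 'rV[C]_m) => P i j ((M *m B) i j)) _ FF) => j.
suff : (fun M : 'rV[C]_m => (M *m B) i j) @ A --> (A *m B) i j.
  by apply; exact: AP.
rewrite mxE; under eq_fun do rewrite mxE.
apply: (cvg_big add_continuous) => k _.
apply: cvgM; [exact: coord_continuous|exact: cvg_cst].
Qed.

Lemma submxrowE j (x : V) : submxrow x j = x *m submxrow 1%:M j.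
Proof. by rewrite mul_submxrow mulmx1. Qed.

Lemma mxrowE_sum (v : forall j, 'rV[C]_(n j)) :
  \mxrow_j v j = \sum_j v j *m submxcol 1%:M j.
Proof. by rewrite -mul_mxrow_mxcol submxcolK mulmx1. Qed.

Lemma submxrow_continuous j : continuous (fun x : V => submxrow x j).
Proof. by rewrite (eq_fun (submxrowE j)); exact: mulmxr_continuous. Qed.

Lemma cvg_mxrow (T : Type) (G : set_system T) (v : forall j, T -> 'rV[C]_(n j))
    (l : forall j, 'rV[C]_(n j)) : Filter G ->
  (forall j, v j @ G --> l j) -> (fun t => \mxrow_j v j t) @ G --> \mxrow_j l j.
Proof.
move=> FG vl; rewrite mxrowE_sum (funext (fun t => mxrowE_sum (v^~ t))).
apply: (cvg_big add_continuous) => j _.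
exact: (cvg_comp _ _ (vl j) (@mulmxr_continuous _ _ (submxcol 1%:M j) (l j))).
Qed.

End BlockRows.

Lemma differentiable_mxrow (R : realType) N (n m : 'I_N -> nat)
    (g : forall j, 'rV[R[i]]_(n j) -> 'rV[R[i]]_(m j))
    (x : 'rV[R[i]]_(\sum_j n j)) :
  (forall j, differentiable (g j) (submxrow x j)) ->
  differentiable (fun y => \mxrow_j g j (submxrow y j)) x.
Proof.
move=> dg.
have -> : (fun y : 'rV[R[i]]_(\sum_j n j) => \mxrow_j g j (submxrow y j)) =
    \sum_j (mulmxr (submxcol 1%:M j) \o g j \o mulmxr (submxrow 1%:M j)).
  apply/funext => y; rewrite fct_sumE mxrowE_sum; apply: eq_bigr => j _.
  by rewrite /= -submxrowE.
apply: differentiable_sum => j; apply: differentiable_comp.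
  by apply: linear_differentiable; exact: mulmxr_continuous.
apply: differentiable_comp; first by rewrite /= -submxrowE; exact: dg.
by apply: linear_differentiable; exact: mulmxr_continuous.
Qed.

Section ProductChart.
Variables (R : realType) (N : nat) (n : 'I_N -> nat).
Variables (T : 'I_N -> topologicalType) (phi : forall j, chart R (n j) (T j)).
Local Notation C := R[i].
Local Notation V := 'rV[C]_(\sum_j n j).

Definition prod_dom : set (prod_topology T) :=
  [set x | forall j, cdom (phi j) (x j)].
Definition prod_map (x : prod_topology T) : V := \mxrow_j cmap (phi j) (x j).
Definition prod_inv (y : V) : prod_topology T :=
  fun j => cinv (phi j) (submxrow y j).

Lemma prod_dom_open : open prod_dom.
Proof. exact: (box_open (fun j => cdom_open (phi j))). Qed.

Lemma prod_mapK x : prod_dom x -> prod_inv (prod_map x) = x.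
Proof.
move=> Dx; apply: functional_extensionality_dep => j.
by rewrite /prod_inv mxrowK cmapK.
Qed.

Lemma prod_imageE : prod_map @` prod_dom =
  [set y | forall j, (cmap (phi j) @` cdom (phi j)) (submxrow y j)].
Proof.
apply/seteqP; split=> [_ [x Dx <-] j|y Dy]; first by rewrite mxrowK; exists (x j).
exists (prod_inv y).
  by move=> j; have [z Dz yz] := Dy j; rewrite /prod_inv -yz cmapK.
apply/mxrowP => j; rewrite mxrowK /prod_inv.
by have [z Dz yz] := Dy j; rewrite -yz cmapK.
Qed.

Lemma prod_image_open : open (prod_map @` prod_dom).
Proof.
rewrite prod_imageE openE => y Dy.
have FF : Filter (nbhs y) by exact: nbhs_filter.
apply: (@filter_forall _ _
  (fun j (z : V) => (cmap (phi j) @` cdom (phi j)) (submxrow z j)) _ FF) => j.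
apply: (@submxrow_continuous R N n j y); apply: open_nbhs_nbhs.
by split; [exact: cimage_open|exact: Dy].
Qed.

Lemma prod_map_continuous x : prod_dom x -> {for x, continuous prod_map}.
Proof.
move=> Dx.
have FF : Filter (nbhs x) by exact: nbhs_filter.
apply: (cvg_mxrow FF) => j.
exact: (cvg_comp _ _ (@proj_continuous _ T j x) (cmap_continuous (Dx j))).
Qed.

Lemma prod_inv_continuous y : (prod_map @` prod_dom) y ->
  {for y, continuous prod_inv}.
Proof.
rewrite prod_imageE => Dy.
have FF : Filter (nbhs y) by exact: nbhs_filter.
apply: cvg_prod_topology => j.
exact: (cvg_comp _ _ (@submxrow_continuous R N n j y)
  (cinv_continuous (Dy j))).
Qed.

Definition prod_chart : chart R (\sum_j n j) (prod_topology T) :=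
  Chart prod_dom_open prod_image_open prod_mapK prod_map_continuous
    prod_inv_continuous.

End ProductChart.

Section ProductManifold.
Variables (R : realType) (N : nat) (n : 'I_N -> nat).
Variable M : forall j, complexManifold R (n j).

Definition prod_space : topologicalType := prod_topology M.

Definition prod_atlas : set (chart R (\sum_j n j) prod_space) :=
  [set prod_chart phi | phi in
    [set phi : forall j, chart R (n j) (M j) | forall j, atlas (phi j)]].

Definition prod_chart_at (p : prod_space) : chart R (\sum_j n j) prod_space :=
  prod_chart (fun j => chart_at (p j)).

Lemma prod_chart_at_atlas p : prod_atlas (prod_chart_at p).
Proof.
by exists (fun j => chart_at (p j)) => // j; exact: chart_at_atlas.
Qed.

Lemma prod_chart_at_dom p : cdom (prod_chart_at p) p.
Proof. by move=> j; exact: chart_at_dom. Qed.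

Lemma prod_transition phi psi : prod_atlas phi -> prod_atlas psi ->
  forall p, cdom phi p -> cdom psi p ->
  differentiable (cmap psi \o cinv phi) (cmap phi p).
Proof.
move=> [f Af <-] [g Ag <-] p fp gp /=.
apply: (@differentiable_mxrow R N n n
  (fun j => cmap (g j) \o cinv (f j)) (prod_map f p)) => j.
by rewrite mxrowK; exact: transition_holomorphic.
Qed.

Lemma prod_hausdorff : hausdorff_space prod_space.
Proof. by apply: hausdorff_product => j; exact: mspace_hausdorff. Qed.

Lemma prod_second_countable : @second_countable prod_space.
Proof. by apply: second_countable_prod => j; exact: mspace_second_countable. Qed.

Definition prod_manifold : complexManifold R (\sum_j n j) :=
  ComplexManifold prod_chart_at_atlas prod_chart_at_dom prod_transition
    prod_hausdorff prod_second_countable.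

End ProductManifold.

Section ProductTangent.
Variables (R : realType) (N : nat) (n : 'I_N -> nat).
Variables (M : forall j, complexManifold R (n j)) (p : prod_manifold M).

Definition prod_proj (j : 'I_N) : M j := p j.

(* The summand of v in T_pM = \bigoplus_j T_{p_j}M_j: the distinguished chart
   at p is the product of the distinguished charts at the p_j. *)
Definition tangent_proj (v : tangent_space p) (j : 'I_N) :
    tangent_space (prod_proj j) := submxrow v j.

End ProductTangent.

(* Main.v *)
From HB Require Import structures.
Require Import Defs.
From mathcomp Require Import all_boot all_order all_algebra.
From mathcomp Require Import all_classical all_reals all_analysis.
From mathcomp Require Import measurable_realfun complex ring lra.

Set Implicit Arguments.
Unset Strict Implicit.
Unset Printing Implicit Defensive.

Import Order.TTheory GRing.Theory Num.Theory.
Import numFieldNormedType.Exports.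
Local Open Scope classical_set_scope.
Local Open Scope complex_scope.
Local Open Scope ring_scope.

(** Two facts make the metric of a product the weighted sum of the metrics of
    its factors.

    - Discs in a product are tuples of discs, so a tangent vector of M has
      Kobayashi length below 1 exactly when each of its components has
      ([kobayashi_prod_lt1]); a real factor in (0, 1] shrinks a disc, which
      absorbs the different speeds of the components.  The convex hull of a
      product is the product of the convex hulls ([hull_box]), and therefore
      the unit ball of the Kobayashi-Busemann norm of M is the product of the
      unit balls of the factors ([busemann_ball_prod]).

    - Over a product of bounded sets D_j invariant under sign change, the mean
      of theta(x) conj(phi(x)) has no cross terms: the integrand
      theta_j(x_j) conj(phi_k(x_k)) with j != k is odd in x_j.  The diagonal
      terms are the means over the D_j.  So the dual Hermitian form of M,
      divided by n + 1, is the orthogonal sum of those of the factors, each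
      divided by n_j + 1 ([gram_box]); dualizing inverts the weights.

    Comparing the mean over the product with the mean over D_j, for unrelated
    Haar measures on the two spaces, is uniqueness of Haar measure: the measure
    A |-> mu {x | x_j in A, x_k in D_k for k != j} is translation invariant,
    hence a multiple of nu_j ([marginal_ex]).  Uniqueness comes from a double
    application of Tonelli's theorem ([haar_swap]).

    To dualize, each form on a factor has to be nondegenerate, so each unit
    ball must be open with finite measure.  It contains a neighbourhood of 0
    because small affine discs in a chart are holomorphic, and it is bounded
    because hyperbolicity bounds the Kobayashi metric below by a Hermitian
    norm.  The Riesz representatives of the factors then assemble, with
    weights (n_j + 1) / (n + 1), into one for M; Hermitian symmetry makes the
    value of the metric independent of the representative used
    ([binet_legendreE]). *)

(** * Complex numbers and complex row vectors *)

Section Rows.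
Variables (R : realType) (n : nat).
Local Notation C := R[i].
Local Notation V := 'rV[C]_n.

Lemma norm_complex_le (z : C) : `|z| <= (`|complex.Re z| + `|complex.Im z|)%:C.
Proof.
case: z => a b; rewrite {1}(_ : a +i* b = a%:C + 'i * b%:C).
  apply: le_trans (ler_normD _ _) _.
  rewrite normrM rmorphD /= !normc_def /= !expr0n /= !addr0 !sqrtr_sqr.
  by rewrite add0r expr1n sqrtr1 mul1r.
by apply/eqP; rewrite eq_complex /= ; rewrite !(mul0r, mul1r, add0r, addr0, subr0, mulr0) !eqxx.
Qed.

Lemma gt0_complexE (e : C) : 0 < e -> exists2 r : R, 0 < r & e = r%:C.
Proof.
case: e => a b; rewrite ltcE /= => /andP[/eqP -> a0].
by exists a.
Qed.

Lemma ge0_complexE (e : C) : 0 <= e -> exists2 r : R, 0 <= r & e = r%:C.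
Proof.
case: e => a b; rewrite lecE /= => /andP[/eqP -> a0].
by exists a.
Qed.

Lemma norm_real_complex (a : R) : `|a%:C : C| = `|a|%:C.
Proof. by rewrite normc_def /= expr0n addr0 sqrtr_sqr. Qed.

Lemma Re_norm_le (z : C) : `|complex.Re z|%:C <= `|z|.
Proof.
case: z => a b; rewrite normc_def lecR /= -sqrtr_sqr ler_wsqrtr// lerDl.
exact: sqr_ge0.
Qed.

Lemma norm_ReE (z : C) : (complex.Re `|z|)%:C = `|z|.
Proof. by have [x _ ->] := ge0_complexE (normr_ge0 z). Qed.

Lemma Im_norm_le (z : C) : `|complex.Im z|%:C <= `|z|.
Proof.
case: z => a b; rewrite normc_def lecR /= -sqrtr_sqr ler_wsqrtr// lerDr.
exact: sqr_ge0.
Qed.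

Lemma ball_rowP (x y : V) (e : C) : 0 < e ->
  ball x e y <-> forall i, `|x 0 i - y 0 i| < e.
Proof.
move=> e0; split=> [[_ xy] i|xy]; first exact: xy.
by split=> // i j; rewrite ord1; exact: xy.
Qed.

Lemma open_borel (U : set V) : open U -> measurable (U : set (borel_space R n)).
Proof. by move=> oU; exact: sub_sigma_algebra. Qed.

Definition rat_row (d : 'rV[rat * rat]_n) : V :=
  \row_i (ratr (d 0 i).1 +i* ratr (d 0 i).2).

Lemma rat_row_dense (x : V) (e : R) : 0 < e -> exists d, ball x e%:C (rat_row d).
Proof.
move=> e0.
have q_ i : exists q : rat * rat,
    `|x 0 i - (ratr q.1 +i* ratr q.2)| < e%:C.
  have e2 : 0 < e / 2 by rewrite divr_gt0.
  have /rat_in_itvoo[p] : complex.Re (x 0 i) - e / 2 < complex.Re (x 0 i) + e / 2.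
    by rewrite ltrD2l gtrN.
  rewrite in_itv/= => pP.
  have /rat_in_itvoo[q] : complex.Im (x 0 i) - e / 2 < complex.Im (x 0 i) + e / 2.
    by rewrite ltrD2l gtrN.
  rewrite in_itv/= => qP.
  exists (p, q); apply: le_lt_trans (norm_complex_le _) _.
  rewrite ltcR [ltRHS]splitr; case: (x 0 i) pP qP => a b /= pP qP.
  by rewrite ltrD// distrC ltr_distl.
have [q qP] := choice q_.
exists (\row_i q i); apply/ball_rowP => [|i]; first by rewrite ltcR.
by rewrite !mxE; exact: qP.
Qed.

End Rows.

(** * Haar measures on C^n *)

Section SigmaFinite.
Variables (R : realType) (d : measure_display) (T : measurableType d).
Variables (m : {measure set T -> \bar R}) (mfin : sigma_finite setT m).

(** A copy of [m] that remembers the proof of sigma-finiteness, which is what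
    Tonelli's theorem looks for in the type of a measure. *)
Definition sigma_finite_alias of sigma_finite setT m : set T -> \bar R := m.
Local Notation m' := (sigma_finite_alias mfin).

HB.instance Definition _ := Measure.copy m' m.
HB.instance Definition _ := Measure_isSigmaFinite.Build d T R m' mfin.

End SigmaFinite.

Section ProductBorel.
Variables (R : realType) (n : nat).
Local Notation C := R[i].
Local Notation V := 'rV[C]_n.
Local Notation B := (borel_space R n).

(** Second countability is the point: an open subset of V * V is the union of
    the countably many products of balls with rational centres and radii 1 / k
    that it contains, so it belongs to the product sigma-algebra. *)
Lemma open_measurable_prod (O : set (V * V)) : open O ->
  measurable (O : set (B * B)).
Proof.
move=> oO.
pose r k : C := (k.+1%:R^-1 : R)%:C.
have r0 k : 0 < r k by rewrite ltcR invr_gt0.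
pose I : set ('rV[rat * rat]_n * 'rV[rat * rat]_n * nat) :=
  [set t | ball (rat_row R t.1.1) (r t.2) `*` ball (rat_row R t.1.2) (r t.2) `<=` O].
have -> : O = \bigcup_(t in I)
   (ball (rat_row R t.1.1) (r t.2) `*` ball (rat_row R t.1.2) (r t.2)).
  apply/seteqP; split=> [[x y] Oxy|z [t It]]; last exact: It.
  have /nbhs_ballP[e /= e0 eO] : nbhs (x, y) O by exact: open_nbhs_nbhs.
  have [s s0 es] := gt0_complexE e0.
  (* Two radii must fit in [s]: the rational balls are centred near x and y,
     not at them. *)
  have [k ks] : exists k, k.+1%:R^-1 + k.+1%:R^-1 < s.
    have [k] : exists k, k.+1%:R^-1 < s / 2 :> R.
      have := near_infty_natSinv_lt (PosNum (divr_gt0 s0 (ltr0n R 2))).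
      by case=> k _ /(_ k (leqnn k)) ?; exists k.
    by move=> ks; exists k; rewrite [ltRHS]splitr ltrD.
  have [dx dxP] := rat_row_dense x (e := k.+1%:R^-1) ltac:(by rewrite invr_gt0).
  have [dy dyP] := rat_row_dense y (e := k.+1%:R^-1) ltac:(by rewrite invr_gt0).
  exists (dx, dy, k); last by split; apply: ball_sym.
  move=> [a b] /= [da db]; apply: eO.
  have rs : r k + r k <= e by rewrite es -rmorphD lecR ltW.
  by split; apply: (le_ball rs); apply: ball_triangle; [exact: dxP|by []|exact: dyP|by []].
rewrite bigcup_mkcond; apply: countable_bigcupT_measurable => [|t].
  exact: countableP.
case: ifP => // _; apply: measurableX; apply: open_borel; exact: ball_open.
Qed.

Lemma continuous_measurable m (f : V -> 'rV[C]_m) : continuous f ->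
  measurable_fun setT (f : B -> borel_space R m).
Proof.
move=> cf; apply: (@measurability _ _ B (borel_space R m) setT f (@open ('rV[C]_m))) => //.
move=> _ [U oU <-].
by rewrite setTI; apply: open_borel; apply: open_comp.
Qed.

Lemma continuous_measurable_prod (f : V * V -> V) : continuous f ->
  measurable_fun setT (f : B * B -> B).
Proof.
move=> cf; apply: (@measurability _ _ (B * B)%type B setT f (@open V)) => //.
move=> _ [U oU <-].
by rewrite setTI; apply: open_measurable_prod; apply: open_comp.
Qed.

Lemma measurable_preimage m (f : V -> 'rV[C]_m) (A : set (borel_space R m)) :
  continuous f -> measurable A -> measurable (f @^-1` A : set B).
Proof.
move=> cf mA; rewrite -[X in measurable X]setTI.
exact: (continuous_measurable cf measurableT mA).
Qed.

Lemma measurable_preimage_prod (f : V * V -> V) (A : set B) :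
  continuous f -> measurable A -> measurable (f @^-1` A : set (B * B)).
Proof.
move=> cf mA; rewrite -[X in measurable X]setTI.
exact: (continuous_measurable_prod cf measurableT mA).
Qed.

Lemma measurable_opp (A : set B) : measurable A ->
  measurable ([set - (x : V) | x in (A : set V)] : set B).
Proof.
move=> mA; rewrite (_ : image _ _ = (-%R : V -> V) @^-1` A).
  apply: (@measurable_preimage n (fun x : V => - x)) => // x.
  exact: (@opp_continuous V).
apply/seteqP; split=> [_ [x Ax <-]|x Ax]; first by rewrite /= opprK.
by exists (- x) => //; rewrite opprK.
Qed.

Definition translation_invariant (m : set B -> \bar R) : Prop :=
  forall (v : V) (A : set B), measurable A -> m [set v + (x : V) | x in (A : set V)] = m A.

Definition locally_finite (m : set B -> \bar R) : Prop :=
  forall r : R, (m (ball (0%R : V) r%:C : set V) < +oo)%E.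

Lemma locally_finite_sigma_finite (m : {measure set B -> \bar R}) :
  locally_finite m -> sigma_finite setT m.
Proof.
move=> fm; exists (fun k => ball (0 : V) (k%:R : R)%:C : set V); last first.
  by move=> k; split; [apply: open_borel; exact: ball_open|exact: fm].
apply/seteqP; split=> // v _.
exists (Num.bound (complex.Re `|v : V|)) => //.
rewrite -ball_normE /= sub0r normrN.
have [x x0 ->] := ge0_complexE (normr_ge0 (v : V)).
by rewrite ltcR; exact: archi_boundP.
Qed.

(** Both sides are iterated integrals of one function.  By Tonelli,
    m(A) nu(D) is the integral of 1_A(x) 1_D(x + y), whose section at y has
    measure m(A & (D - y)) = m((A + y) & D); the latter are the sections of
    1_D(x) 1_A(x - y), whose integral is m(D) nu(-A). *)
Lemma haar_swap (m nu : {measure set B -> \bar R}) :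
  translation_invariant m -> locally_finite m ->
  translation_invariant nu -> locally_finite nu ->
  forall A D : set B, measurable A -> measurable D ->
  (m A * nu D = m D * nu [set (- (x : V))%R | x in (A : set V)])%E.
Proof.
move=> im fm inu fnu A D mA mD.
pose m' : {sigma_finite_measure set B -> \bar R} :=
  sigma_finite_alias (locally_finite_sigma_finite fm).
pose nu' : {sigma_finite_measure set B -> \bar R} :=
  sigma_finite_alias (locally_finite_sigma_finite fnu).
pose E1 : set (B * B) := [set z | A z.1 /\ D ((z.1 : V) + (z.2 : V))].
pose E2 : set (B * B) := [set z | D z.1 /\ A ((z.1 : V) - (z.2 : V))].
have mfst X : measurable X -> measurable ([set z | X z.1] : set (B * B)).
  by move=> mX; rewrite -[X in measurable X]setTI; exact: measurable_fst.
have mE1 : measurable E1.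
  apply: measurableI; first exact: mfst.
  by apply: (@measurable_preimage_prod (fun z => z.1 + z.2)) => //; exact: add_continuous.
have mE2 : measurable E2.
  apply: measurableI; first exact: mfst.
  apply: (@measurable_preimage_prod (fun z => z.1 - z.2)) => // z.
  by apply: cvgB; [exact: cvg_fst|exact: cvg_snd].
have := indic_fubini_tonelli m' nu' mE1.
have := indic_fubini_tonelli m' nu' mE2.
rewrite !indic_fubini_tonelli_FE// !indic_fubini_tonelli_GE//.
(* Translating by y carries the section of [E1] at y onto that of [E2]. *)
have -> : m' \o ysection E1 = m' \o ysection E2.
  apply/funext => y /=; rewrite -[LHS](im y); last exact: measurable_ysection.
  congr (m _); apply/seteqP; split => x.
    move=> [z]; rewrite /ysection /= !inE /= => -[Az Dz] <-.
    by split => /=; rewrite ?[y + z]addrC ?addrK.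
  rewrite /ysection /= inE /= => -[Dx Ax]; exists ((x : V) - y); last by rewrite addrC subrK.
  by rewrite inE; split; rewrite //= subrK.
(* In the other order the sections over [A] and over [D] are translates of one
   set, up to a reflection, so the integrand is constant on its support. *)
have section_cst (E : set (B * B)) (X : set B) c : measurable X ->
    (forall x, X x -> nu (xsection E x) = c) ->
    (forall x, ~ X x -> xsection E x = set0) ->
    (\int[m']_x (nu' \o xsection E) x = c * m X)%E.
  move=> mX EX EnX; rewrite -integral_cst// [RHS]integral_mkcond.
  apply: eq_integral => x _ /=; rewrite patchE; case: ifPn => [/set_mem /EX //|].
  by move=> /negP nX; rewrite EnX ?measure0// => Xx; apply: nX; exact/mem_set.
move=> <-; rewrite (section_cst E1 A (nu D)) // => [|x Ax|x nAx]; first last.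
- by apply/seteqP; split => y //; rewrite /xsection /= inE => -[].
- rewrite -[RHS](inu (- (x : V)))//; congr (nu _); apply/seteqP; split=> y.
    rewrite /xsection /= inE => -[_ /= Dxy].
    by exists ((x : V) + y) => //; rewrite addKr.
  by move=> [z Dz <-]; rewrite /xsection /= inE; split; rewrite //= addrA subrr add0r.
rewrite (section_cst E2 D (nu [set (- (x : V))%R | x in (A : set V)])) //.
- by rewrite muleC => ->; rewrite muleC.
- move=> x Dx; rewrite -[RHS](inu (x : V)); last exact: measurable_opp.
  congr (nu _); apply/seteqP; split=> y.
    rewrite /xsection /= inE => -[_ /= Axy].
    exists (- ((x : V) - y)); first by exists ((x : V) - y).
    by rewrite opprB addrC subrK.
  move=> [_ [z Az <-] <-]; rewrite /xsection /= inE; split; rewrite //= opprD opprK.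
  by rewrite addrA subrr add0r.
- by move=> x nDx; apply/seteqP; split => y //; rewrite /xsection /= inE => -[].
Qed.

End ProductBorel.

Section Pushforward.
Variables (R : realType) (d d' : measure_display).
Variables (T : measurableType d) (T' : measurableType d').
Variables (mu : {measure set T -> \bar R}) (f : T -> T').

(** Image and restricted measures as bundled measures whose values are known:
    the proof of measurability cannot be inferred from the set function. *)
Lemma pushforward_measure_ex : measurable_fun setT f ->
  exists m : {measure set T' -> \bar R}, (m : set T' -> \bar R) = pushforward mu f.
Proof.
by move=> mf; unshelve eexists; first refine (pushforward mu f : {measure set T' -> \bar R}).
Qed.

Lemma mrestr_measure_ex (D : set T) : measurable D ->
  exists m : {measure set T -> \bar R},
    (m : set T -> \bar R) = fun A => mu (A `&` D).
Proof.
by move=> mD; exists (mrestr mu mD : {measure set T -> \bar R}).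
Qed.

End Pushforward.

Section Haar.
Variables (R : realType) (n : nat).
Local Notation C := R[i].
Local Notation V := 'rV[C]_n.
Local Notation B := (borel_space R n).

(** Apply [haar_swap] to the unit ball K and A: since K = -K, it reads
    m(K) nu(A) = m(A) nu(K). *)
Lemma haar_unique (m nu : {measure set B -> \bar R}) :
  translation_invariant m -> locally_finite m ->
  translation_invariant nu -> locally_finite nu ->
  (0 < nu (ball (0%R : V) 1 : set V))%E ->
  exists2 c : R, (c%:E * nu (ball (0%R : V) 1 : set V) = m (ball (0%R : V) 1 : set V))%E &
    forall A : set B, measurable A -> (m A = c%:E * nu A)%E.
Proof.
set K : set B := (ball (0%R : V) 1 : set V) => im fm inu fnu K0.
have mK : measurable K by apply: open_borel; exact: ball_open.
have mKfin : m K \is a fin_num by rewrite ge0_fin_numE //; exact: (fm 1).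
have nuKfin : nu K \is a fin_num by rewrite ge0_fin_numE //; exact: (fnu 1).
have NK : [set (- (x : V))%R | x in (K : set V)] = K.
  have sK x : K x -> K (- (x : V))%R by rewrite /K -ball_normE /= !sub0r !normrN.
  apply/seteqP; split=> [_ [x Kx <-]|x Kx]; first exact: sK.
  by exists (- (x : V))%R; [exact: sK|rewrite opprK].
have nuK0 : fine (nu K) != 0 by rewrite gt_eqF// fine_gt0// K0 ltey_eq nuKfin.
exists (fine (m K) / fine (nu K)).
  by rewrite -{2}(fineK nuKfin) -EFinM divfK// fineK.
move=> A mA; have := haar_swap im fm inu fnu mK mA; rewrite NK => H.
rewrite -[LHS]mule1.
have -> : 1%E = (nu K * ((fine (nu K))^-1)%:E)%E.
  by rewrite -{1}(fineK nuKfin) -EFinM divff.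
rewrite muleA -H EFinM (fineK mKfin) -!muleA; congr (_ * _)%E.
by rewrite muleC.
Qed.

Lemma complex_of_continuous : continuous (fun z : R * R => z.1 +i* z.2 : C).
Proof.
move=> z; apply/cvg_ballP => e /gt0_complexE[r r0 ->].
have : \forall w \near z, ball z (r / 2) w by apply: nbhsx_ballx; rewrite divr_gt0.
apply: filterS => -[a b] [/=]; rewrite /ball /= => za zb.
apply: le_lt_trans (norm_complex_le _) _ => /=.
by rewrite ltcR [ltRHS]splitr ltrD.
Qed.

Lemma polydisc_compact (r : R) : compact [set v : V | forall i,
  `|complex.Re (v 0 i)| <= r /\ `|complex.Im (v 0 i)| <= r].
Proof.
pose D : set C := (fun z : R * R => z.1 +i* z.2) @` (`[- r, r] `*` `[- r, r]).
have cD : compact D.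
  apply: continuous_compact; last by apply: compact_setX; exact: segment_compact.
  by apply: continuous_subspaceT; exact: complex_of_continuous.
have := @rV_compact C n (fun=> D) (fun=> cD).
congr compact; apply/seteqP; split=> v vD i.
  by have [[a b] [/=]] := vD i; rewrite !in_itv/= => ra rb <- /=; rewrite !ler_norml.
have [] := vD i; rewrite !ler_norml => ra rb.
by exists (complex.Re (v 0 i), complex.Im (v 0 i)) => /=; [rewrite !in_itv|case: (v 0 i)].
Qed.

Variable mu : {measure set B -> \bar R}.
Hypothesis hmu : haar_measure mu.

Lemma haar_inv : translation_invariant mu. Proof. by case: hmu. Qed.

Lemma haar_locally_finite : locally_finite mu.
Proof.
move=> r; have [_ fK _] := hmu.
apply: le_lt_trans (fK _ (@polydisc_compact r)).
apply: le_measure; rewrite ?inE.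
- by apply: open_borel; exact: ball_open.
- suff : closed [set v : V | forall i,
      `|complex.Re (v 0 i)| <= r /\ `|complex.Im (v 0 i)| <= r].
    move=> cK; rewrite -[X in measurable X]setCK; apply: measurableC.
    by apply: open_borel; exact: closed_openC.
  apply: compact_closed; last exact: polydisc_compact.
  exact: norm_hausdorff.
move=> v [r0 vr] i; have := vr 0 i; rewrite /ball /= mxE sub0r normrN => /ltW vir.
by split; rewrite -lecR; apply: le_trans vir; [exact: Re_norm_le|exact: Im_norm_le].
Qed.

Lemma haar_ball_gt0 (r : R) : 0 < r -> (0 < mu (ball (0%R : V) r%:C : set V))%E.
Proof.
move=> r0; have [_ _] := hmu; apply; first exact: ball_open.
by exists 0; apply: ballxx; rewrite ltcR.
Qed.

Lemma haar_bounded_fin (A : set B) (r : R) : measurable A ->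
  (A : set V) `<=` ball (0 : V) r%:C -> (mu A < +oo)%E.
Proof.
move=> mA Ar; apply: le_lt_trans (haar_locally_finite r).
by apply: le_measure => //; rewrite inE//; apply: open_borel; exact: ball_open.
Qed.

(** The image of [mu] is again a Haar measure, hence a multiple of [mu]; the
    unit ball, which an isometry preserves, shows that the factor is 1. *)
Lemma haar_isometry (T : V -> V) : continuous T -> {morph T : x y / x + y} ->
  bijective T -> (forall x, `|T x| = `|x|) ->
  forall A : set B, measurable A -> mu (T @^-1` A) = mu A.
Proof.
move=> cT TD [T' TK T'K] nT.
have [m mE] := pushforward_measure_ex mu (continuous_measurable cT).
have T0 : T 0 = 0 by apply: (addrI (T 0)); rewrite -TD !addr0.
have TN x : T (- x) = - T x by apply: (addrI (T x)); rewrite -TD !subrr.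
have TB r : T @^-1` (ball (0 : V) r) = ball (0 : V) r.
  by apply/seteqP; split => x; rewrite -ball_normE /= !sub0r !normrN nT.
have im : translation_invariant m.
  move=> v A mA; rewrite mE /pushforward.
  have -> : T @^-1` [set v + x | x in (A : set V)] =
      [set T' v + x | x in (T @^-1` A)].
    apply/seteqP; split=> x /=.
      move=> [y Ay vyTx]; exists (x - T' v); last by rewrite addrC subrK.
      by rewrite /= TD TN T'K -vyTx addrC addKr.
    by move=> [y Ay <-]; exists (T y) => //; rewrite TD T'K.
  by rewrite haar_inv//; exact: measurable_preimage.
have fm : locally_finite m.
  by move=> r; rewrite mE /pushforward TB; exact: haar_locally_finite.
have mu1 := @haar_ball_gt0 1 ltr01.
have [c + cE] := haar_unique im fm haar_inv haar_locally_finite mu1.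
have muf : mu (ball (0%R : V) 1 : set V) \is a fin_num.
  by rewrite ge0_fin_numE; [exact: (haar_locally_finite 1)|].
have nK : fine (mu (ball (0%R : V) 1 : set V)) != 0.
  by rewrite gt_eqF// fine_gt0// mu1 ltey_eq muf.
rewrite [in X in X -> _]mE /pushforward TB -(fineK muf) -EFinM => -[] /(canRL (mulfK nK)) c1.
by move=> A mA; have := cE A mA; rewrite mE /pushforward => ->; rewrite c1 divff// mul1e.
Qed.

End Haar.

(** * Transport of integrals between measures *)

Section Integrals.
Variables (R : realType) (d : measure_display) (T : measurableType d).
Implicit Types (D E : set T) (f : T -> R) (mu m : {measure set T -> \bar R}).

Lemma Rintegral_proportional mu m (c : R) D f : 0 <= c -> measurable D ->
  (forall A, measurable A -> A `<=` D -> (m A = c%:E * mu A)%E) ->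
  mu.-integrable D (EFin \o f) ->
  Rintegral m D f = c * Rintegral mu D f.
Proof.
move=> c0 mD mc fi.
have mf := measurable_int mu fi.
rewrite /Rintegral (@eq_measure_integral _ _ _ _ (mscale (NngNum c0) mu)); last first.
  by move=> A mA AD; rewrite mc// /mscale /=.
have -> : c * fine (\int[mu]_(x in D) (f x)%:E) = fine (c%:E * \int[mu]_(x in D) (f x)%:E).
  by rewrite fineM//; exact: integrable_fin_num.
congr fine; rewrite integralE [in RHS]integralE.
rewrite !ge0_integral_mscale //=; first last.
- exact: measurable_funepos.
- exact: measurable_funeneg.
apply/esym; apply: muleBr => //; apply: fin_num_adde_defr.
by apply: integrable_fin_num => //; exact: integrable_funepos.
Qed.

(** The complement of [D] is a null set of the restricted measure [m]. *)
Lemma Rintegral_restrict mu m D E f : measurable D -> measurable E -> D `<=` E ->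
  (forall A, measurable A -> (m A = mu (A `&` D))%E) -> (mu D < +oo)%E ->
  measurable_fun setT f -> [bounded f x | x in E] ->
  Rintegral m E f = Rintegral mu D f.
Proof.
move=> mD mE DE mm Dfin mf bf; rewrite /Rintegral; congr fine.
rewrite (@negligible_integral _ _ _ m E (~` D)) //; first last.
- by rewrite mm ?setICl ?measure0//; exact: measurableC.
- apply: measurable_bounded_integrable => //; last exact: measurable_funTS.
  by rewrite mm// (setIidr DE).
- exact: measurableC.
rewrite setDE setCK (setIidr DE).
by apply: eq_measure_integral => A mA AD; rewrite mm// (setIidl AD).
Qed.

End Integrals.

Lemma Rintegral_pushforward (R : realType) d d' (T : measurableType d)
    (T' : measurableType d') (mu : {measure set T -> \bar R})
    (m : {measure set T' -> \bar R}) (phi : T -> T') (D : set T') (f : T' -> R) :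
  measurable_fun setT phi -> (m : set T' -> \bar R) = pushforward mu phi ->
  measurable D -> (mu (phi @^-1` D) < +oo)%E ->
  measurable_fun setT f -> [bounded f x | x in D] ->
  Rintegral m D f = Rintegral mu (phi @^-1` D) (f \o phi).
Proof.
move=> mphi mE mD Dfin mf bf; rewrite /Rintegral; congr fine.
rewrite -[RHS](@integral_pushforward _ _ _ _ _ phi mphi mu D (EFin \o f)) //.
- by apply: eq_measure_integral => A _ _; rewrite mE.
- exact: measurableT_comp.
apply: measurable_bounded_integrable => //.
- by rewrite -[X in measurable X]setTI; exact: mphi.
- apply: measurable_funTS; exact: measurableT_comp.
- move: bf; rewrite /bounded_near; apply: filterS => M bM x Dx; exact: bM.
Qed.

(** * Measures and integrals on products of bounded sets *)

Section Blocks.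
Variables (R : realType) (N : nat) (n : 'I_N -> nat).
Local Notation C := R[i].
Local Notation V := 'rV[C]_(\sum_j n j).
Local Notation B := (borel_space R (\sum_j n j)).
Implicit Type x : V.

Lemma row_norm_eq m (x y : 'rV[C]_m) : (forall i, `|x 0 i| = `|y 0 i|) -> `|x| = `|y|.
Proof.
move=> xy; rewrite /Num.Def.normr /= !mx_normE; congr (_%:num).
by apply: eq_bigr => -[i j] _; apply/val_inj; rewrite /= ord1 xy.
Qed.

Lemma submxrow_row_entry x j i : submxrow x j 0 i = x 0 (tagnat.Rank j i).
Proof. by rewrite mxE. Qed.

Lemma row_entry x k : x 0 k = submxrow x (tagnat.sig1 k) 0 (tagnat.sig2 k).
Proof. by rewrite submxrow_row_entry tagnat.sig2K. Qed.

Lemma ball_blocks (r : R) x : 0 < r ->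
  ball (0 : V) r%:C x <-> forall j, ball (0 : 'rV[C]_(n j)) r%:C (submxrow x j).
Proof.
move=> r0; have rC0 : 0 < (r%:C : C) by rewrite ltcR.
split=> [/(ball_rowP _ _ rC0) xr j|xr].
  apply/(ball_rowP _ _ rC0) => i; have := xr (tagnat.Rank j i).
  by rewrite !mxE.
apply/(ball_rowP _ _ rC0) => k.
by have /(ball_rowP _ _ rC0)/(_ (tagnat.sig2 k)) := xr (tagnat.sig1 k); rewrite !mxE tagnat.sig2K.
Qed.

Lemma submxrow_mxrowD j x (y : V) : submxrow (x + y) j = submxrow x j + submxrow y j.
Proof. by apply/rowP => i; rewrite !mxE. Qed.

Definition embed j (v : 'rV[C]_(n j)) : V := \mxrow_k dfwith (fun=> 0) j v k.

Lemma submxrow_embed j (v : 'rV[C]_(n j)) : submxrow (embed v) j = v.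
Proof. by rewrite /embed mxrowK dfwithin. Qed.

Lemma submxrow_embed_out j k (v : 'rV[C]_(n j)) : k != j -> submxrow (embed v) k = 0.
Proof. by move=> kj; rewrite /embed mxrowK dfwithout // eq_sym. Qed.

Definition reflect_block j x : V :=
  \mxrow_k (if k == j then - submxrow x k else submxrow x k).

Lemma reflect_blockK j : involutive (reflect_block j).
Proof.
move=> x; apply/mxrowP => k; rewrite !mxrowK.
by case: eqP => // _; rewrite opprK.
Qed.

Lemma reflect_blockD j : {morph reflect_block j : x y / x + y}.
Proof.
move=> x y; apply/mxrowP => k; rewrite submxrow_mxrowD !mxrowK submxrow_mxrowD.
by case: ifP => // _; rewrite opprD.
Qed.

Lemma reflect_block_norm j x : `|reflect_block j x| = `|x|.
Proof.
apply: row_norm_eq => k; rewrite !row_entry mxrowK; case: ifP => // _.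
by rewrite mxE normrN.
Qed.

Lemma reflect_block_continuous j : continuous (reflect_block j).
Proof.
move=> x; have FF : Filter (nbhs x) by exact: nbhs_filter.
apply: (@cvg_mxrow R N n V (nbhs x)
  (fun k (y : V) => if k == j then - submxrow y k else submxrow y k)
  (fun k => if k == j then - submxrow x k else submxrow x k) FF) => k.
case: ifP => _; last exact: submxrow_continuous.
exact: (cvg_comp _ _ (@submxrow_continuous R N n k x)
  (@opp_continuous 'rV[C]_(n k) (submxrow x k))).
Qed.

Variable mu : {measure set B -> \bar R}.
Hypothesis hmu : haar_measure mu.
Variable D : forall j, set ('rV[C]_(n j)).
Hypothesis mD : forall j, measurable (@D j : set (borel_space R (n j))).
Variable r : 'I_N -> R.
Hypothesis Dr : forall j, @D j `<=` ball (0 : 'rV[C]_(n j)) (r j)%:C.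

Definition box : set V := [set x | forall j, D (submxrow x j)].
Definition marginal_box j (A : set 'rV[C]_(n j)) : set V :=
  [set x | A (submxrow x j) /\ forall k, k != j -> D (submxrow x k)].

Lemma box_marginal j : box = marginal_box (@D j).
Proof.
apply/seteqP; split=> [x Dx|x [Dj Dk] k]; first by split.
by have [->|/Dk] := eqVneq k j.
Qed.

Lemma measurable_submxrow j (A : set (borel_space R (n j))) : measurable A ->
  measurable ((fun x : V => submxrow x j) @^-1` A : set B).
Proof. by move=> mA; apply: measurable_preimage => //; exact: submxrow_continuous. Qed.

Lemma measurable_marginal_box j (A : set (borel_space R (n j))) :
  measurable A -> measurable (marginal_box A : set B).
Proof.
move=> mA; apply: measurableI; first exact: measurable_submxrow.
rewrite [X in measurable X](_ : _ = \bigcap_(k in [set k | k != j])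
   ((fun x : V => submxrow x k) @^-1` @D k)).
  apply: fin_bigcap_measurable => [|k _]; first exact: finite_finset.
  exact: measurable_submxrow.
by apply/seteqP; split=> x Dx k /= kj; exact: Dx.
Qed.

Lemma measurable_box : measurable (box : set B).
Proof.
rewrite (_ : box = \bigcap_(k in setT) ((fun x : V => submxrow x k) @^-1` @D k)).
  apply: fin_bigcap_measurable => [|k _]; first exact: finite_finset.
  exact: measurable_submxrow.
by apply/seteqP; split=> [x Dx k _|x Dx k]; [exact: Dx|exact: (Dx k)].
Qed.

Lemma marginal_box_fin j (A : set 'rV[C]_(n j)) (s : R) :
  measurable (A : set (borel_space R (n j))) ->
  A `<=` ball (0 : 'rV[C]_(n j)) s%:C -> (mu (marginal_box A) < +oo)%E.
Proof.
move=> mA As; pose t := 1 + `|s| + \sum_k `|r k|.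
have t0 : 0 < t by rewrite /t -addrA ltr_pwDl// addr_ge0// sumr_ge0.
apply: (haar_bounded_fin hmu (r := t)); first exact: measurable_marginal_box.
move=> x [Aj Dk]; apply/(ball_blocks _ t0) => k.
have [kj|kj] := eqVneq k j.
  rewrite kj; apply: (@le_ball _ _ _ s%:C); last exact: As.
  rewrite lecR (le_trans (ler_norm s))// /t -addrA addrCA lerDl addr_ge0//.
  exact: sumr_ge0.
apply: (@le_ball _ _ _ (r k)%:C); last exact/Dr/Dk.
rewrite lecR (le_trans (ler_norm (r k)))// /t (bigD1 k)//= addrCA lerDl.
by rewrite !addr_ge0// sumr_ge0.
Qed.

(** As a function of A, the measure of the marginal box is invariant under
    translations, because translating A by v translates the box by the vector
    with j-th block v and no other; so it is proportional to Haar measure. *)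
Lemma marginal_ex j (nu : {measure set (borel_space R (n j)) -> \bar R}) :
  haar_measure nu ->
  exists2 c : R, 0 <= c & forall A : set (borel_space R (n j)), measurable A ->
    mu (marginal_box A) = (c%:E * nu A)%E.
Proof.
move=> hnu.
pose S := [set x : V | forall k, k != j -> D (submxrow x k)].
have mS : measurable (S : set B).
  have := @measurable_marginal_box j setT measurableT.
  by rewrite /marginal_box [X in measurable X](_ : _ = S)//; apply/seteqP; split=> x //= -[].
have mpr : measurable_fun setT (fun x : B => submxrow (x : V) j : borel_space R (n j)).
  by apply: continuous_measurable; exact: submxrow_continuous.
have [m0 m0E] := mrestr_measure_ex mu mS.
have [m mE] := pushforward_measure_ex m0 mpr.
have {mE m0E}mE A : m A = mu (marginal_box A) by rewrite mE /pushforward m0E.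
have im : translation_invariant m.
  move=> v A mA; rewrite !mE -[RHS](haar_inv hmu (embed v)); last exact: measurable_marginal_box.
  congr (mu _); apply/seteqP; split=> x.
    move=> [[y Ay vyx] Dx]; exists (x - embed v); last by rewrite addrC subrK.
    split=> [|k kj].
      have -> : submxrow (x - embed v) j = submxrow x j - v.
        by rewrite -[v in RHS]submxrow_embed; apply/rowP => i; rewrite !mxE.
      by rewrite -vyx addrC addKr.
    have -> : submxrow (x - embed v) k = submxrow x k - 0.
      by rewrite -(submxrow_embed_out v kj); apply/rowP => i; rewrite !mxE.
    by rewrite subr0; exact: Dx.
  move=> [y [Ay Dy] <-]; split=> [|k kj].
    by rewrite /= submxrow_mxrowD submxrow_embed; exists (submxrow y j).
  by rewrite submxrow_mxrowD submxrow_embed_out// add0r; exact: Dy.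
have fm : locally_finite m.
  move=> s; rewrite mE; apply: marginal_box_fin; last exact: subset_refl.
  by apply: open_borel; exact: ball_open.
have nu0 := haar_ball_gt0 hnu ltr01.
have [c cE mc] := haar_unique im fm (haar_inv hnu) (haar_locally_finite hnu) nu0.
exists c; last by move=> A mA; rewrite -mE mc.
have : (0 <= c%:E * nu (ball (0%R : 'rV[C]_(n j)) 1 : set 'rV[C]_(n j)))%E.
  by rewrite cE measure_ge0.
by rewrite pmule_lge0.
Qed.

(** The constant of proportionality of [marginal_ex] occurs in the integral
    and in the volume alike, and cancels. *)
Lemma box_mean j (nu : {measure set (borel_space R (n j)) -> \bar R})
    (g : 'rV[C]_(n j) -> R) : haar_measure nu ->
  (0 < mu (box : set B))%E ->
  measurable_fun setT (g : borel_space R (n j) -> R) ->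
  [bounded g v | v in @D j] ->
  Rintegral mu (box : set B) (fun x => g (submxrow x j)) / fine (mu (box : set B)) =
  Rintegral nu (@D j : set (borel_space R (n j))) g /
    fine (nu (@D j : set (borel_space R (n j)))).
Proof.
move=> hnu box0 mg bg.
have boxfin : (mu (box : set B) < +oo)%E.
  by rewrite (box_marginal j); exact: (marginal_box_fin (@mD j) (@Dr j)).
have nuD : (nu (@D j : set (borel_space R (n j))) < +oo)%E.
  exact: (haar_bounded_fin hnu (@mD j) (@Dr j)).
have [c c0 cE] := marginal_ex hnu.
have muE : mu (box : set B) = (c%:E * nu (@D j : set (borel_space R (n j))))%E.
  by rewrite (box_marginal j); exact: cE.
have mpr : measurable_fun setT (fun x : B => submxrow (x : V) j : borel_space R (n j)).
  by apply: continuous_measurable; exact: submxrow_continuous.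
have [m0 m0E] := mrestr_measure_ex mu measurable_box.
have [m mE] := pushforward_measure_ex m0 mpr.
have sub : box `<=` (fun x : V => submxrow x j) @^-1` @D j by move=> x; exact.
have bgp : [bounded g (submxrow (x : V) j) | x in (fun x : V => submxrow x j) @^-1` @D j].
  by move: bg; rewrite /bounded_near; apply: filterS => M bM x Dx; exact: bM.
have -> : Rintegral mu (box : set B) (fun x => g (submxrow x j)) =
    c * Rintegral nu (@D j : set (borel_space R (n j))) g.
  rewrite -(@Rintegral_restrict _ _ _ mu m0 _ _ _ measurable_box
    (measurable_submxrow (@mD j)) sub) //; first last.
  - by apply: (measurableT_comp mg mpr).
  - by move=> A mA; rewrite m0E.
  rewrite -(Rintegral_pushforward mpr mE) //; last first.
    by rewrite m0E (setIidr sub).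
  apply: Rintegral_proportional => //.
    move=> A mA AD; rewrite mE /pushforward m0E -cE//; congr (mu _).
    apply/seteqP; split=> x.
      by move=> [Ax Dx]; split => // k _; exact: Dx.
    by move=> [Ax Dx]; split => //; rewrite (box_marginal j); split => //; exact: AD.
  by apply: measurable_bounded_integrable => //; exact: measurable_funTS.
rewrite muE fineM//; last by rewrite ge0_fin_numE.
have cn0 : c != 0 by apply: contraTneq box0 => cz; rewrite muE cz mul0e ltxx.
by rewrite invfM mulrACA divff// mul1r.
Qed.

(** The reflection of the j-th block preserves [mu], the box and, up to sign,
    the function: the integral is its own opposite. *)
Lemma box_odd_integral j (f : V -> R) :
  (forall v, D v -> @D j (- v)) -> (forall x, f (reflect_block j x) = - f x) ->
  measurable_fun setT (f : B -> R) -> [bounded f x | x in box] ->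
  Rintegral mu (box : set B) f = 0.
Proof.
move=> Dsym fodd mf bf.
have boxfin : (mu (box : set B) < +oo)%E.
  by rewrite (box_marginal j); exact: (marginal_box_fin (@mD j) (@Dr j)).
have boxT : reflect_block j @^-1` box = box.
  have sub x : box x -> box (reflect_block j x).
    move=> Dx k; rewrite mxrowK; case: eqP => [->|_]; last exact: Dx.
    exact/Dsym/Dx.
  by apply/seteqP; split=> x; [move=> /sub; rewrite /= reflect_blockK|exact: sub].
have mT : measurable_fun setT (reflect_block j : B -> B).
  by apply: continuous_measurable; exact: reflect_block_continuous.
have fi : mu.-integrable (box : set B) (EFin \o f).
  apply: measurable_bounded_integrable => //; first exact: measurable_box.
  exact: measurable_funTS.
have [m mE] := pushforward_measure_ex mu mT.
have /eqP : Rintegral mu (box : set B) f = - Rintegral mu (box : set B) f.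
  rewrite -mulN1r -RintegralZl//; last exact: measurable_box.
  rewrite [RHS](_ : _ = Rintegral mu (box : set B) (f \o reflect_block j)); last first.
    by apply: eq_Rintegral => x _ /=; rewrite fodd mulN1r.
  have := Rintegral_pushforward mT mE measurable_box.
  rewrite /= boxT => <- //; rewrite /Rintegral; congr fine.
  apply: eq_measure_integral => A mA _; rewrite mE /pushforward.
  apply/esym; apply: (haar_isometry hmu) => //.
  - exact: reflect_block_continuous.
  - exact: reflect_blockD.
  - exact: inv_bij (@reflect_blockK j).
  - exact: reflect_block_norm.
by rewrite -subr_eq0 opprK -mulr2n -mulr_natl mulf_eq0 pnatr_eq0 /= => /eqP.
Qed.

End Blocks.

(** * Holomorphic discs *)

Section DiscCalculus.
Variable R : realType.
Local Notation C := R[i].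

Lemma differentiable_mxrow_fun (N : nat) (m : 'I_N -> nat)
    (g : forall j, C -> 'rV[C]_(m j)) (z : C) :
  (forall j, differentiable (g j) z) ->
  differentiable (fun y => \mxrow_j g j y : 'rV[C]_(\sum_j m j)) z.
Proof.
move=> dg; rewrite (_ : (fun y => _) = \sum_j (mulmxr (submxcol 1%:M j) \o g j)).
  apply: differentiable_sum => j; apply: differentiable_comp; first exact: dg.
  by apply: linear_differentiable; exact: mulmxr_continuous.
apply/funext => y; rewrite fct_sumE mxrowE_sum; exact: eq_bigr.
Qed.

Lemma differentiable_submxrow (N : nat) (m : 'I_N -> nat)
    (g : C -> 'rV[C]_(\sum_j m j)) (z : C) j : differentiable g z ->
  differentiable (fun y => submxrow (g y) j) z /\
  derive1 (fun y => submxrow (g y) j) z = submxrow (derive1 g z) j.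
Proof.
move=> dg; rewrite (_ : (fun y => _) = mulmxr (submxrow 1%:M j) \o g); last first.
  by apply/funext => y; rewrite /= -submxrowE.
have dB : differentiable (mulmxr (submxrow 1%:M j) :
    'rV[C]_(\sum_j m j) -> 'rV[C]_(m j)) (g z).
  by apply: linear_differentiable; exact: mulmxr_continuous.
split; first exact: differentiable_comp.
rewrite derive1E'; last exact: differentiable_comp.
rewrite diff_comp//= derive1E'// diff_lin; last exact: mulmxr_continuous.
by rewrite [RHS]submxrowE.
Qed.

Lemma differentiable_line (W : normedModType C) (a v : W) (z : C) :
  differentiable (fun y : C => a + y *: v) z.
Proof.
exact: (@differentiableD _ _ _ (cst a) (fun y : C => y *: v)).
Qed.

Lemma derive1_line (W : normedModType C) (a v : W) (z : C) :
  derive1 (fun y : C => a + y *: v) z = v.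
Proof.
rewrite derive1E'; last exact: differentiable_line.
have dv : differentiable (fun y : C => y *: v) z.
  by apply: (@differentiableZl _ _ _ id).
rewrite (_ : (fun y : C => a + y *: v) = cst a \+ (fun y : C => y *: v)) //.
have dE : 'd (fun y : C => y *: v) z 1 = v.
  have idE : 'd (id : C -> C) z 1 = 1 := congr1 (@^~ 1) (@diff_val _ _ _ _ _ _ _ (is_diff_id z)).
  by rewrite (congr1 (@^~ 1) (@diffZl _ _ _ id v z _))// idE scale1r.
have cE : 'd (cst a : C -> W) z 1 = 0 := congr1 (@^~ 1) (diff_cst a z).
have aE : 'd (cst a \+ (fun y : C => y *: v)) z 1 =
    'd (cst a : C -> W) z 1 + 'd (fun y : C => y *: v) z 1.
  exact: (congr1 (@^~ 1) (diffD (differentiable_cst a z) dv)).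
exact: (etrans aE (etrans (congr2 +%R cE dE) (add0r v))).
Qed.

Lemma derive1_scale (W : normedModType C) (g : C -> W) (c : C) :
  differentiable g 0 -> derive1 (fun z => g (c * z)) 0 = c *: derive1 g 0.
Proof.
move=> dg.
have cE : (fun z : C => c * z) = (fun z : C => 0 + z *: (c : C)).
  by apply/funext => z; rewrite add0r mulrC.
have dc : differentiable (fun z : C => c * z : C) 0.
  by rewrite cE; exact: differentiable_line.
have dg0 : differentiable g ((fun z : C => c * z) 0) by rewrite mulr0.
apply: (etrans (derive1E' (differentiable_comp dc dg0))).
apply: (etrans (congr1 (@^~ 1) (diff_comp dc dg0))).
have c1 : 'd (fun z : C => c * z : C) 0 1 = c *: (1 : C).
  by rewrite -(derive1E' dc) {1}cE derive1_line; exact: esym (mulr1 c).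
apply: (etrans (congr1 ('d g (c * 0)) c1)).
rewrite mulr0 linearZ; congr (_ *: _).
by rewrite (derive1E' dg).
Qed.

End DiscCalculus.

Section Discs.
Variables (R : realType) (n : nat) (M : complexManifold R n).
Local Notation C := R[i].
Implicit Types (p : M) (u v : 'rV[C]_n).

(** The initial velocities of discs through [p], read in the distinguished
    chart.  With lambda absorbed in [u], the indicatrix is described by
    rescaling vectors instead of comparing infima. *)
Definition disc_velocity p u : Prop :=
  exists f : C -> M, [/\ holomorphic_disc f, f 0 = p &
    derive1 (cmap (chart_at p) \o f : C -> 'rV[C]_n) 0 = u].

(** Precompose the disc with z |-> c z, which maps the unit disc to itself. *)
Lemma disc_velocityZ p u (c : C) : `|c| <= 1 ->
  disc_velocity p u -> disc_velocity p (c *: u).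
Proof.
move=> c1 [f [hf f0 fu]].
have cz (z : C) : `|z| < 1 -> `|c * z| < 1.
  by move=> z1; rewrite normrM; apply: le_lt_trans z1; rewrite ler_piMl.
have cc (z : C) : {for z, continuous (fun y : C => c * y)}.
  rewrite (_ : (fun y => _) = (fun y : C => 0 + y *: (c : C))).
    exact: differentiable_continuous (differentiable_line _ _ _).
  by apply/funext => y; rewrite add0r mulrC.
exists (fun z => f (c * z)); split.
- move=> z z1; have [cf df] := hf _ (cz _ z1); split.
    exact: (cvg_comp _ _ (cc z) cf).
  move=> phi aphi fphi.
  have -> : (cmap phi \o (fun z => f (c * z)) : C -> 'rV[C]_n) =
    (cmap phi \o f) \o (fun z : C => 0 + z *: (c : C)).
    by apply/funext => y /=; rewrite add0r; congr (cmap phi (f _)); exact: mulrC.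
  apply: differentiable_comp; first exact: differentiable_line.
  have zc : z *: (c : C) = c * z := mulrC z c.
  by rewrite add0r zc; exact: df.
- by rewrite mulr0.
have [_ df] := hf 0 ltac:(by rewrite normr0).
rewrite -fu -derive1_scale//; apply: df; first exact: chart_at_atlas.
by rewrite f0; exact: chart_at_dom.
Qed.

Lemma cinvK (T : topologicalType) (phi : chart R n T) y :
  (cmap phi @` cdom phi) y -> cmap phi (cinv phi y) = y /\ cdom phi (cinv phi y).
Proof. by move=> [x Dx <-]; rewrite cmapK. Qed.

(** The affine disc z |-> a + z u in the distinguished chart at [p] stays in
    the image of the chart as long as [u] is small. *)
Lemma small_disc_velocity p :
  exists2 e : R, 0 < e & forall u, `|u| < e%:C -> disc_velocity p u.
Proof.
set phi := chart_at p; set a := cmap phi p.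
have Dp : cdom phi p := chart_at_dom p.
have /nbhs_ballP[e0 /= e00 eI] : nbhs a (cmap phi @` cdom phi).
  by apply: open_nbhs_nbhs; split; [exact: cimage_open|exists p].
have [e e_gt0 eE] := gt0_complexE e00; exists e => // u ue.
have inI (z : C) : `|z| < 1 -> (cmap phi @` cdom phi) (a + z *: u).
  move=> z1; apply: eI; rewrite eE -ball_normE /= opprD addrA subrr sub0r normrN.
  by rewrite normrZ; apply: le_lt_trans ue; rewrite ler_piMl// ltW.
exists (fun z => cinv phi (a + z *: u)); split.
- move=> z /inI zI; split.
    exact: (cvg_comp _ _ (differentiable_continuous (differentiable_line a u z))
      (cinv_continuous zI)).
  move=> psi apsi Dpsi.
  have -> : (cmap psi \o (fun z => cinv phi (a + z *: u)) : C -> 'rV[C]_n) =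
    (cmap psi \o cinv phi) \o (fun z : C => a + z *: u) by [].
  apply: differentiable_comp; first exact: differentiable_line.
  have [zK zD] := cinvK zI.
  rewrite -zK; apply: transition_holomorphic => //; exact: chart_at_atlas.
- by rewrite scale0r addr0 cmapK.
(* [cmap] inverts [cinv] only on the image of the chart, so the composite with
   the disc is affine only on the unit disc. *)
rewrite derive1E -[RHS](derive1_line a u 0) derive1E; apply: near_eq_derive.
have : \forall z \near (0 : C), `|z| < 1.
  have : \forall z \near (0 : C), ball (0 : C) 1 z by apply: nbhsx_ballx.
  by apply: filterS => z; rewrite -ball_normE /= sub0r normrN.
by apply: filterS => z /inI /cinvK[].
Qed.

Lemma disc_velocity_ex p u : exists2 l : R, 0 < l & disc_velocity p (l%:C *: u).
Proof.
have [e e0 eP] := small_disc_velocity p.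
have [k k0 uk] := ge0_complexE (normr_ge0 u).
have k1 : 0 < 1 + k by rewrite ltr_pwDl.
exists (e / (1 + k)); first by rewrite divr_gt0.
apply: eP; rewrite normrZ uk norm_real_complex.
rewrite ger0_norm ?divr_ge0 ?ltW// -rmorphM ltcR.
by rewrite mulrAC ltr_pdivrMr// ltr_pM2l// ltrDr.
Qed.

(** The infimum defining the Kobayashi metric is over a nonempty set, by
    [disc_velocity_ex]; without that an empty infimum would count as 0. *)
Lemma kobayashi_lt1P p u : kobayashi (u : tangent_space p) < 1 <->
  exists2 lambda : R, 1 < lambda & disc_velocity p (lambda%:C *: u).
Proof.
rewrite /kobayashi; set S := (X in inf X).
have S0 : lbound S 0 by move=> _ [l [l0 _] <-]; rewrite invr_ge0 ltW.
split=> [|[l l1 dl]].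
  move=> /inf_lt[]; last first.
    move=> _ [l [l0 fl] <-]; rewrite invf_lt1// => l1; exists l => //.
  by have [l l0 dl] := disc_velocity_ex p u; exists l^-1, l.
apply: (@le_lt_trans _ _ l^-1); last by rewrite invf_lt1// (lt_trans ltr01).
by apply: ge_inf; [exists 0|exists l => //; split => //; rewrite (lt_trans ltr01)].
Qed.

End Discs.

Section ProductDiscs.
Variables (R : realType) (N : nat) (n : 'I_N -> nat).
Variables (M : forall j, complexManifold R (n j)) (p : prod_manifold M).
Local Notation C := R[i].

(** A map into the product is holomorphic iff its components are, in product
    charts.  To test the j-th component in a given chart, that chart is
    completed to a product chart with distinguished charts in the other
    factors. *)
Lemma disc_velocity_prod (u : 'rV[C]_(\sum_j n j)) :
  disc_velocity p u <-> forall j, disc_velocity (prod_proj p j) (submxrow u j).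
Proof.
split=> [[f [hf f0 fu]] j|].
  have hfj : holomorphic_disc (fun z => (f z : prod_topology M) j : M j).
    move=> z z1; have [cf df] := hf z z1; split.
      exact: (cvg_comp _ _ cf (@proj_continuous _ M j (f z))).
    move=> phi aphi Dphi.
    pose psi := dfwith (fun k => chart_at ((f z : prod_topology M) k)) j phi.
    have apsi : atlas (prod_chart psi : chart R _ (prod_manifold M)).
      exists psi => // k; rewrite /psi; case: dfwithP => // i _.
      exact: chart_at_atlas.
    have Dpsi : cdom (prod_chart psi : chart R _ (prod_manifold M)) (f z).
      by move=> k; rewrite /psi; case: dfwithP => // i _; exact: chart_at_dom.
    have [+ _] := differentiable_submxrow j (df _ apsi Dpsi).
    rewrite (_ : (fun y => _) =
      (cmap phi \o (fun z => (f z : prod_topology M) j) : C -> 'rV[C]_(n j))) //.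
    by apply/funext => y /=; rewrite mxrowK /psi dfwithin.
  exists (fun z => (f z : prod_topology M) j); split => //; first by rewrite f0.
  have [_ df] := hf 0 ltac:(by rewrite normr0).
  have Dp : cdom (chart_at p) (f 0) by rewrite f0; exact: chart_at_dom.
  have [_] := differentiable_submxrow j (df _ (chart_at_atlas p) Dp).
  rewrite fu => <-; congr (derive1 _ 0).
  by apply/funext => y /=; rewrite mxrowK.
move=> /(_ _)/cid - /all_sig[f fP].
have hf j : holomorphic_disc (f j) by have [] := fP j.
have f0 j : f j 0 = prod_proj p j by have [] := fP j.
exists (fun z => (fun j => f j z) : prod_topology M).
have hF : holomorphic_disc (fun z => (fun j => f j z) : prod_manifold M).
  move=> z z1; split.
    have FF : Filter (nbhs z) by exact: nbhs_filter.
    have FG := fmap_filter (fun z => (fun j => f j z) : prod_topology M) FF.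
    by apply: (cvg_prod_topology FG) => j; have [] := hf j z z1.
  move=> _ [psi apsi <-] Dpsi.
  apply: (@differentiable_mxrow_fun _ _ _ (fun j => cmap (psi j) \o f j)) => j.
  by have [_] := hf j z z1; apply; [exact: apsi|exact: Dpsi].
have F0 : (fun j => f j 0) = p :> prod_topology M.
  by apply: functional_extensionality_dep => j; exact: f0.
split => //; apply/mxrowP => j.
have [_ df] := hF 0 ltac:(by rewrite normr0).
have Dp : cdom (chart_at p) ((fun j => f j 0) : prod_manifold M).
  by rewrite F0; exact: chart_at_dom.
have [_ <-] := differentiable_submxrow j (df _ (chart_at_atlas p) Dp).
have [_ _ <-] := fP j; congr (derive1 _ 0).
by apply/funext => y /=; rewrite mxrowK.
Qed.

(** Discs of speeds l_j > 1 in the factors are slowed down to a common speed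
    min_j l_j > 1. *)
Lemma kobayashi_prod_lt1 (u : 'rV[C]_(\sum_j n j)) :
  kobayashi (u : tangent_space p) < 1 <->
  forall j, kobayashi (submxrow u j : tangent_space (prod_proj p j)) < 1.
Proof.
have submxrowZ (c : C) (v : 'rV[C]_(\sum_j n j)) j :
    submxrow (c *: v) j = c *: submxrow v j.
  by apply/rowP => i; rewrite !mxE.
split=> [/kobayashi_lt1P[l l1 /disc_velocity_prod dl] j|ku].
  by apply/kobayashi_lt1P; exists l => //; have := dl j; rewrite submxrowZ.
have /(_ _)/kobayashi_lt1P/cid2 - /all_sig2[l l1 dl] := ku.
(* The default value 2 keeps the minimum above 1 even over an empty family. *)
pose m : R := \big[Num.min/2]_j l j.
have m1 : 1 < m by apply/bigmin_gtP; split=> [|j _]; [rewrite ltr1n|exact: l1].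
apply/kobayashi_lt1P; exists m => //; apply/disc_velocity_prod => j.
have lj0 : 0 < l j by exact: lt_trans (l1 j).
have ml : m <= l j by exact: bigmin_le_cond.
rewrite submxrowZ -[m](@divfK _ (l j)) ?gt_eqF// rmorphM -scalerA.
apply: disc_velocityZ; last exact: dl.
rewrite norm_real_complex lecR ger0_norm.
  by rewrite ler_pdivrMr// mul1r.
by rewrite divr_ge0// ltW// (lt_trans ltr01).
Qed.

End ProductDiscs.

(** * Convex hulls and their gauges *)

Section Hull.
Variables (R : realType) (n : nat).
Local Notation C := R[i].
Local Notation V := 'rV[C]_n.
Implicit Types (A K : set V) (v : V).

(** A complex number between 0 and 1 is real, so convexity with weights in
    R[i] is real convexity. *)
Lemma convex_setP K : @convex_set C V K <->
  forall x y (t : R), 0 <= t <= 1 -> K x -> K y -> K (t%:C *: x + (1 - t)%:C *: y).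
Proof.
split=> [cK x y t /andP[t0 t1] Kx Ky|cK x y l /set_mem Kx /set_mem Ky].
  have tC0 : 0 <= (t%:C : C) by rewrite lecR.
  have tC1 : (t%:C : C) <= 1 by rewrite lecR.
  have : K (t%:C *: x + (1 - t%:C) *: y) :=
    set_mem (cK x y (Itv01 tC0 tC1) (mem_set Kx) (mem_set Ky)).
  by rewrite rmorphB.
apply/mem_set.
have [l0 l1] : 0 <= l%:num /\ l%:num <= 1 by [].
suff : K (l%:num *: x + (1 - l%:num) *: y) by [].
move: (l%:num) l0 l1 => [a b]; rewrite !lecE /= => /andP[/eqP -> a0] /andP[_ a1].
by have := cK x y a; rewrite rmorphB /= a0 a1; apply.
Qed.

Definition hull A : set V := smallest (@convex_set C V) A.

Lemma sub_hull A : A `<=` hull A. Proof. exact: sub_smallest. Qed.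

Lemma hull_min A K : @convex_set C V K -> A `<=` K -> hull A `<=` K.
Proof. by move=> cK AK; exact: smallest_sub. Qed.

Lemma hull_convex A x y (t : R) : 0 <= t <= 1 ->
  hull A x -> hull A y -> hull A (t%:C *: x + (1 - t)%:C *: y).
Proof.
move=> t01 Hx Hy K [cK AK].
by apply: (convex_setP K).1 => //; [exact: Hx|exact: Hy].
Qed.

(** The open unit ball of the gauge of the convex hull, described without an
    infimum. *)
Definition gauge_ball A : set V :=
  [set v | exists2 t : R, 0 < t < 1 & hull A ((t^-1)%:C *: v)].

Variables (A : set V) (e : R).
Hypotheses (e0 : 0 < e) (Ae : ball (0 : V) e%:C `<=` A).

Lemma hull_star v (t : R) : 0 <= t <= 1 -> hull A v -> hull A (t%:C *: v).
Proof.
move=> t01 Hv; rewrite -[_ *: _]addr0 -[X in _ + X](scaler0 _ (1 - t)%:C).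
apply: hull_convex => //; apply: sub_hull; apply: Ae.
by rewrite -ball_normE /= subr0 normr0 ltcR.
Qed.

Lemma gauge_ball0 : gauge_ball A 0.
Proof.
exists 2^-1; first by rewrite invr_gt0 ltr0n invf_lt1 ?ltr1n// ltr0n.
by rewrite scaler0; apply: sub_hull; apply: Ae; rewrite -ball_normE /= subr0 normr0 ltcR.
Qed.

(** If v / t is in the hull with t < 1 and t < s < 1, then w / s is, for w close
    to v, a convex combination of v / t and of (w - v) / (s - t), which lies in
    the ball contained in [A]. *)
Lemma gauge_ball_open : open (gauge_ball A).
Proof.
rewrite openE => v [t /andP[t0 t1] Hv].
pose s := (1 + t) / 2.
have ts : t < s by rewrite /s; lra.
have s1 : s < 1 by rewrite /s; lra.
have s0 : 0 < s := lt_trans t0 ts.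
have st0 : 0 < s - t by rewrite subr_gt0.
have : \forall w \near v, ball v (e * (s - t))%:C w.
  by apply: nbhsx_ballx; rewrite ltcR mulr_gt0.
apply: filterS => w; rewrite -ball_normE /= => vw.
exists s; first by rewrite s0.
have -> : (s^-1)%:C *: w = (t / s)%:C *: ((t^-1)%:C *: v) +
   (1 - t / s)%:C *: (((s - t)^-1)%:C *: (w - v)).
  rewrite !scalerA -!rmorphM.
  have -> : t / s * t^-1 = s^-1 by field; rewrite !gt_eqF.
  have -> : (1 - t / s) * (s - t)^-1 = s^-1 by field; rewrite !gt_eqF.
  by rewrite -scalerDr addrC subrK.
apply: hull_convex => //.
  by rewrite divr_ge0 ?(ltW t0) ?(ltW s0)//= ler_pdivrMr// mul1r ltW.
apply: sub_hull; apply: Ae; rewrite -ball_normE /= sub0r normrN normrZ.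
rewrite norm_real_complex gtr0_norm ?invr_gt0//.
by rewrite distrC -(@ltr_pM2l _ (s - t)%:C) ?ltcR// mulrA -!rmorphM divff ?gt_eqF// mul1r mulrC.
Qed.

Lemma gauge_ball_sym : (forall v, A v -> A (- v)) ->
  forall v, gauge_ball A v -> gauge_ball A (- v).
Proof.
move=> As v [t t01 Hv]; exists t => //; rewrite scalerN.
suff : hull A `<=` [set w | hull A (- w)] by apply.
apply: hull_min => [|w Aw]; last by apply: sub_hull; exact: As.
apply/convex_setP => x y s s01 /= Hx Hy.
by rewrite opprD -!scalerN; exact: hull_convex.
Qed.

Lemma gauge_ball_bounded (r : R) : 0 < r -> A `<=` ball (0 : V) r%:C ->
  gauge_ball A `<=` ball (0 : V) r%:C.
Proof.
move=> r0 Ar v [t /andP[t0 t1] Hv].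
have : hull A `<=` ball (0 : V) r%:C.
  apply: hull_min => //; apply/convex_setP => x y s /andP[s0 s1].
  rewrite -ball_normE /= !sub0r !normrN => xr yr.
  have [->|s_neq0] := eqVneq s 0; first by rewrite scale0r add0r subr0 scale1r.
  have s_gt0 : 0 < s by rewrite lt_neqAle eq_sym s_neq0.
  apply: le_lt_trans (ler_normD _ _) _.
  rewrite !normrZ !norm_real_complex !ger0_norm ?subr_ge0//.
  have -> : r%:C = s%:C * r%:C + (1 - s)%:C * r%:C :> C.
    by rewrite -mulrDl -rmorphD addrC subrK mul1r.
  rewrite ltr_leD//.
    by rewrite ltr_pM2l// ltcR.
  by apply: ler_wpM2l; rewrite ?lecR ?subr_ge0// ltW.
move=> /(_ _ Hv); rewrite -ball_normE /= !sub0r !normrN normrZ norm_real_complex.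
rewrite gtr0_norm ?invr_gt0// => /lt_trans - /(_ (t^-1 * r)%:C).
rewrite rmorphM /= ltr_pM2l ?ltcR ?invr_gt0//; apply.
by rewrite -rmorphM ltcR ltr_pMl// invf_gt1.
Qed.

End Hull.

Section ProductHull.
Variables (R : realType) (N : nat) (n : 'I_N -> nat).
Local Notation C := R[i].
Local Notation V := 'rV[C]_(\sum_j n j).
Variable A : forall j, set 'rV[C]_(n j).
Local Notation prodA := (box A).

Lemma submxrow_conv (x y : V) (a b : C) j :
  submxrow (a *: x + b *: y) j = a *: submxrow x j + b *: submxrow y j.
Proof. by apply/rowP => i; rewrite !mxE. Qed.

(** The hard inclusion replaces one block at a time: with the other blocks
    fixed, the set of k-th blocks that keep the vector in the hull of the
    product is convex and contains A_k, so it contains the hull of A_k. *)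
Lemma hull_box : hull prodA = box (fun j => hull (@A j)).
Proof.
apply/seteqP; split.
  apply: hull_min; last by move=> x Ax j; exact: sub_hull.
  apply/convex_setP => x y t t01 Hx Hy j; rewrite submxrow_conv.
  exact: hull_convex.
(* The blocks listed in [s] range over the hulls, the others over the A_j. *)
suff H (s : seq 'I_N) (x : V) :
    (forall j, if j \in s then hull (@A j) (submxrow x j) else A (submxrow x j)) ->
    hull prodA x.
  by move=> x Hx; apply: (H (enum 'I_N)) => j; rewrite mem_enum; exact: Hx.
elim: s x => [x Ax|k s IHs x Hx]; first by apply: sub_hull => j; exact: Ax.
pose repl (y : 'rV[C]_(n k)) : V := \mxrow_j dfwith (submxrow x) k y j.
suff : hull (@A k) `<=` [set y | hull prodA (repl y)].
  have -> : x = repl (submxrow x k).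
    apply/mxrowP => j; rewrite /repl mxrowK.
    by have [->|jk] := eqVneq j k; rewrite ?dfwithin// dfwithout// eq_sym.
  apply.
  by have := Hx k; rewrite mem_head.
apply: hull_min.
  apply/convex_setP => y z t t01 /= Hy Hz.
  have -> : repl (t%:C *: y + (1 - t)%:C *: z) = t%:C *: repl y + (1 - t)%:C *: repl z.
    apply/mxrowP => j; rewrite submxrow_conv /repl !mxrowK.
    have [->|jk] := eqVneq j k; first by rewrite !dfwithin.
    by rewrite !dfwithout// 1?eq_sym// -scalerDl -rmorphD addrC subrK scale1r.
  exact: hull_convex.
move=> y Ay /=; apply: IHs => j; rewrite /repl mxrowK.
have [->|jk] := eqVneq j k.
  by rewrite dfwithin; case: ifP => // _; exact: sub_hull.
by rewrite dfwithout 1?eq_sym//; have := Hx j; rewrite inE (negbTE jk).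
Qed.

(** Factors t_j < 1 for the blocks are replaced by their maximum, since the
    hulls are star-shaped about 0. *)
Lemma gauge_ball_box (e : 'I_N -> R) : (forall j, 0 < e j) ->
  (forall j, ball (0 : 'rV[C]_(n j)) (e j)%:C `<=` @A j) ->
  gauge_ball prodA = box (fun j => gauge_ball (@A j)).
Proof.
move=> e0 Ae; apply/seteqP; split=> [x [t t01] + j|x Bx].
  rewrite hull_box => /(_ j) Hx; exists t => //.
  by rewrite (_ : _ *: _ = submxrow ((t^-1)%:C *: x) j)//; apply/rowP => i; rewrite !mxE.
have /(_ _)/cid2 - /all_sig2[t t01 tH] := Bx.
(* The default value 1/2 keeps the maximum positive over an empty family. *)
pose s : R := \big[Num.max/2^-1]_j t j.
have ts j : t j <= s by exact: le_bigmax.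
have s01 : 0 < s < 1.
  apply/andP; split.
    by apply: (@lt_le_trans _ _ 2^-1); [rewrite invr_gt0|exact: bigmax_ge_id].
  apply/bigmax_ltP; split=> [|j _]; first by rewrite invf_lt1// ltr1n.
  by have /andP[] := t01 j.
have /andP[s0 s1] := s01.
exists s => //; rewrite hull_box => j.
rewrite (_ : submxrow _ j = (t j / s)%:C *: (((t j)^-1)%:C *: submxrow x j)).
  have /andP[t0 _] := t01 j.
  apply: (hull_star (e0 j) (@Ae j)); last exact: tH.
  by rewrite divr_ge0 ?(ltW t0) ?(ltW s0)//= ler_pdivrMr// mul1r.
have /andP[t0 _] := t01 j.
rewrite scalerA -rmorphM mulrAC divff ?gt_eqF// mul1r.
by apply/rowP => i; rewrite !mxE.
Qed.

End ProductHull.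

(** * The unit ball of the Kobayashi-Busemann norm *)

Section Riesz.
Variables (R : realType) (n : nat).
Local Notation C := R[i].
Local Notation V := 'rV[C]_n.
Variable f : V -> V -> C.
Hypothesis flin : forall w a u v, f (a *: u + v) w = a * f u w + f v w.
Hypothesis fconj : forall w a u v, f w (a *: u + v) = Num.conj a * f w u + f w v.
Hypothesis fdef : forall u, f u u = 0 -> u = 0.

Let G : 'M[C]_n := \matrix_(i, j) f (delta_mx 0 i) (delta_mx 0 j).

Let f0l w : f 0 w = 0.
Proof.
have := flin w 1 0 0; rewrite scale1r addr0 mul1r => /esym /(canRL (addrK _)).
by rewrite subrr.
Qed.

Let f0r w : f w 0 = 0.
Proof.
have := fconj w 1 0 0; rewrite scale1r addr0 rmorph1 mul1r.
by move=> /esym /(canRL (addrK _)); rewrite subrr.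
Qed.

Let fsuml (I : Type) (s : seq I) (a : I -> C) (u : I -> V) w :
  f (\sum_(i <- s) a i *: u i) w = \sum_(i <- s) a i * f (u i) w.
Proof.
elim: s => [|i s IHs]; first by rewrite !big_nil f0l.
by rewrite !big_cons flin IHs.
Qed.

Let fsumr (I : Type) (s : seq I) (a : I -> C) (u : I -> V) w :
  f w (\sum_(i <- s) a i *: u i) = \sum_(i <- s) Num.conj (a i) * f w (u i).
Proof.
elim: s => [|i s IHs]; first by rewrite !big_nil f0r.
by rewrite !big_cons fconj IHs.
Qed.

Let fE u v : f u v = (u *m G *m (map_mx Num.conj v)^T) 0 0.
Proof.
rewrite {1}(row_sum_delta u) fsuml -mulmxA mxE; apply: eq_bigr => i _; congr (_ * _).
rewrite {1}(row_sum_delta v) fsumr mxE; apply: eq_bigr => j _.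
by rewrite !mxE mulrC.
Qed.

(** Definiteness makes the Gram matrix of the standard basis injective, hence
    invertible; its inverse produces the representative. *)
Lemma riesz_row (b : V) : exists d, forall u, f u d = \sum_i u 0 i * b 0 i.
Proof.
have Gu : G \in unitmx.
  rewrite -row_free_unit; apply: inj_row_free => u uG0.
  by apply: fdef; rewrite fE uG0 mul0mx mxE.
exists (map_mx Num.conj (invmx G *m b^T)^T) => u; rewrite fE.
have -> : (map_mx Num.conj (map_mx Num.conj (invmx G *m b^T)^T))^T = invmx G *m b^T.
  by apply/matrixP => i j; rewrite !mxE conjCK.
by rewrite mulmxA mulmxK// mxE; apply: eq_bigr => i _; rewrite !mxE.
Qed.

End Riesz.

Section Indicatrix.
Variables (R : realType) (n : nat) (M : complexManifold R n) (p : M).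
Local Notation C := R[i].
Local Notation V := 'rV[C]_n.
Local Notation A := (@kobayashi_indicatrix R n M p : set V).

Lemma indicatrix_ball : exists2 e : R, 0 < e & ball (0 : V) e%:C `<=` A.
Proof.
have [e e0 eP] := small_disc_velocity p.
exists (e / 2); first by rewrite divr_gt0.
move=> v; rewrite -ball_normE /= sub0r normrN => ve.
apply/kobayashi_lt1P; exists 2; first by rewrite ltr1n.
apply: eP; rewrite normrZ norm_real_complex ger0_norm//.
have -> : e%:C = 2%:C * (e / 2)%:C :> C by rewrite -rmorphM mulrC divfK.
by rewrite ltr_pM2l// ltcR.
Qed.

Lemma indicatrix_sym (v : V) : A v -> A (- v).
Proof.
move=> /kobayashi_lt1P[l l1 dl]; apply/kobayashi_lt1P; exists l => //.
by rewrite scalerN -scaleN1r; apply: disc_velocityZ => //; rewrite normrN normr1.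
Qed.

(** As for [kobayashi_lt1P], the infimum is over a nonempty set: every vector
    has a positive multiple in the indicatrix. *)
Lemma unit_ball_busemann :
  (unit_ball (@kobayashi_busemann R n M p) : set V) = gauge_ball A.
Proof.
have [e e0 eA] := indicatrix_ball.
have hullE (v : V) : hull A v = smallest (@convex_set _ (tangent_space p)) A v by [].
apply/seteqP; split=> v; rewrite /unit_ball /gauge_ball /= /kobayashi_busemann;
  set S := (X in inf X).
  move=> /inf_lt[]; last by move=> t [t0 St] t1; exists t => //; rewrite t0.
  have [l l0 dl] := disc_velocity_ex p v.
  exists (2 / l); split; first by rewrite divr_gt0.
  rewrite -hullE; apply: sub_hull; apply/kobayashi_lt1P; exists 2; first by rewrite ltr1n.
  by rewrite scalerA -rmorphM invfM invrK mulrA divff// mul1r.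
move=> [t /andP[t0 t1] Hv]; apply: le_lt_trans t1.
apply: ge_inf; last by split.
by exists 0 => s [s0 _]; exact: ltW.
Qed.

(** Let h be the Hermitian form given by hyperbolicity at [p] and d_i the
    vectors with h(v, d_i) = v_i.  By Cauchy-Schwarz |v_i|^2 is at most
    h(v, v) h(d_i, d_i), and h(v, v) is at most 1 / c^2 on the indicatrix. *)
Lemma indicatrix_bounded : kobayashi_hyperbolic M ->
  exists2 r : R, 0 < r & A `<=` ball (0 : V) r%:C.
Proof.
move=> /(_ p)[U pU [h [c c0 [_ hk]]]].
have Up : U p := nbhs_singleton pU.
have h1 w a u v : h p (a *: u + v) w = a * h p u w + h p v w by rewrite linearPl.
have h2 w a u v : h p w (a *: u + v) = Num.conj a * h p w u + h p w v by rewrite linearPr.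
have h3 u : h p u u = 0 -> u = 0 by move=> /eqP; rewrite dnorm_eq0 => /eqP.
have /(_ _)/cid - /all_sig[d dE] := fun i : 'I_n => riesz_row h1 h2 h3 (delta_mx 0 i).
have {}dE i (v : V) : h p v (d i) = v 0 i.
  rewrite dE (bigD1 i)//= mxE !eqxx mulr1 big1 ?addr0// => j ji.
  by rewrite mxE eqxx /= (negbTE ji) mulr0.
have b_ i : {b : R | 0 <= b & h p (d i) (d i) = b%:C}.
  by apply: cid2; apply: ge0_complexE; exact: dnorm_ge0.
pose r := 1 + \sum_i c^-1 ^+ 2 * s2val (b_ i).
have r1 : 1 <= r.
  by rewrite lerDl sumr_ge0// => i _; rewrite mulr_ge0 ?sqr_ge0//; case: (b_ i).
have r0 : 0 < r := lt_le_trans ltr01 r1.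
exists r => // v Av; apply/ball_rowP => [|i]; first by rewrite ltcR.
rewrite mxE sub0r normrN.
have [a a0 ha] := ge0_complexE (dnorm_ge0 (h p) v).
have [x x0 vx] := ge0_complexE (normr_ge0 (v 0 i)).
have a_lt : a <= c^-1 ^+ 2.
  have := le_lt_trans (hk p Up v) Av; rewrite ha /= => ca.
  rewrite -(sqr_sqrtr a0) ler_sqr ?nnegrE ?sqrtr_ge0 ?invr_ge0 ?(ltW c0)//.
  by rewrite ltW// -[ltRHS]mul1r ltr_pdivlMr// mulrC.
have := (CauchySchwarz (h p) v (d i)).1.
rewrite dE vx ha; case bE : (b_ i) => [b b0 hb].
rewrite hb -rmorphXn -rmorphM lecR => x2.
rewrite ltcR -ltr_sqr ?nnegrE ?(ltW r0)//.
apply: (@le_lt_trans _ _ (c^-1 ^+ 2 * b)).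
  by apply: (le_trans x2); exact: ler_wpM2r.
apply: (@lt_le_trans _ _ r); last by rewrite expr2 ler_peMr// ltW.
rewrite /r (bigD1 i)//= bE /= addrCA ltrDl ltr_pwDl// sumr_ge0// => k _.
by rewrite mulr_ge0 ?sqr_ge0//; case: (b_ k).
Qed.

End Indicatrix.

(** * Integration of complex functions *)

Section ComplexMean.
Variables (R : realType) (n : nat).
Local Notation C := R[i].
Local Notation V := 'rV[C]_n.
Local Notation B := (borel_space R n).

Lemma Re_continuous : continuous (@complex.Re R : C -> R).
Proof.
move=> z; have FF : Filter (nbhs z) by exact: nbhs_filter.
apply/cvg_ballP => e e0.
have : \forall w \near z, ball z (e%:C) w by apply: nbhsx_ballx; rewrite ltcR.
apply: (@filterS _ _ FF) => w; rewrite -!ball_normE /= => zw.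
rewrite -ltcR; apply: le_lt_trans zw.
by have := Re_norm_le (z - w); clear FF; case: z => a b; case: w.
Qed.

Lemma Im_continuous : continuous (@complex.Im R : C -> R).
Proof.
move=> z; have FF : Filter (nbhs z) by exact: nbhs_filter.
apply/cvg_ballP => e e0.
have : \forall w \near z, ball z (e%:C) w by apply: nbhsx_ballx; rewrite ltcR.
apply: (@filterS _ _ FF) => w; rewrite -!ball_normE /= => zw.
rewrite -ltcR; apply: le_lt_trans zw.
by have := Im_norm_le (z - w); clear FF; case: z => a b; case: w.
Qed.

Lemma continuous_measurable_real (f : V -> R) : continuous f ->
  measurable_fun setT (f : B -> R).
Proof.
move=> cf; apply: (@measurability _ _ B R setT f _ (RGenOpens.measurableE R)).
move=> _ [_ [a [b ->]] <-]; rewrite setTI; apply: open_borel.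
by apply: open_comp => //; exact: interval_open.
Qed.

(** Encoding functionals by columns turns their restriction to a block into
    [submxcol] and the Riesz representation into matrix inversion. *)
Definition colfun (A : 'cV[C]_n) (v : V) : C := (v *m A) 0 0.

Lemma colfun_continuous A : continuous (colfun A).
Proof.
move=> v; exact: (cvg_comp _ _ (@mulmxr_continuous _ _ _ A v)
  (@coord_continuous C 1 1 0 0 (v *m A))).
Qed.

Variable D : set V.

(** Measurable everywhere and bounded on [D]: sufficient for integrability over
    [D] when it has finite measure, and stable under products. *)
Definition tame (f : V -> C) : Prop :=
  [/\ measurable_fun setT ((fun v => complex.Re (f v)) : B -> R),
      measurable_fun setT ((fun v => complex.Im (f v)) : B -> R) &
      exists K : R, forall v, D v -> `|f v| <= K%:C].

Lemma tame_colfun A (r : R) : D `<=` ball (0 : V) r%:C -> tame (colfun A).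
Proof.
move=> Dr; split.
- apply: continuous_measurable_real => v.
  exact: (cvg_comp _ _ (@colfun_continuous A v) (@Re_continuous _)).
- apply: continuous_measurable_real => v.
  exact: (cvg_comp _ _ (@colfun_continuous A v) (@Im_continuous _)).
exists (\sum_i r * complex.Re `|A i 0|) => v /Dr[r0 vr].
rewrite /colfun mxE; apply: le_trans (ler_norm_sum _ _ _) _.
rewrite rmorph_sum; apply: ler_sum => i _; rewrite normrM [leRHS]rmorphM.
rewrite -[`|A i 0| in leLHS]norm_ReE; apply: ler_wpM2r; first by rewrite norm_ReE.
apply: ltW.
by have := vr 0 i; rewrite /ball /= mxE sub0r normrN.
Qed.

Lemma tame_conj f : tame f -> tame (fun v => Num.conj (f v)).
Proof.
move=> [mRe mIm [K fK]]; split.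
- by rewrite (_ : (fun v => _) = (fun v => complex.Re (f v)))//; apply/funext => v; case: (f v).
- rewrite (_ : (fun v => _) = (fun v => - complex.Im (f v))).
    exact: measurable_funN.
  by apply/funext => v; case: (f v).
by exists K => v Dv; rewrite norm_conjC; exact: fK.
Qed.

Lemma tameM f g : tame f -> tame g -> tame (fun v => f v * g v).
Proof.
move=> [fRe fIm [K fK]] [gRe gIm [L gL]]; split.
- rewrite (_ : (fun v => _) =
    (fun v => complex.Re (f v) * complex.Re (g v) - complex.Im (f v) * complex.Im (g v))).
    by apply: measurable_funB; apply: measurable_funM.
  by apply/funext => v; case: (f v) => a b; case: (g v).
- rewrite (_ : (fun v => _) =
    (fun v => complex.Re (f v) * complex.Im (g v) + complex.Im (f v) * complex.Re (g v))).
    by apply: measurable_funD; apply: measurable_funM.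
  by apply/funext => v; case: (f v) => a b; case: (g v).
exists (K * L) => v Dv; rewrite normrM rmorphM.
by apply: ler_pM => //; [exact: fK|exact: gL].
Qed.

Lemma tameD f g : tame f -> tame g -> tame (fun v => f v + g v).
Proof.
move=> [fRe fIm [K fK]] [gRe gIm [L gL]]; split.
- rewrite (_ : (fun v => _) = (fun v => complex.Re (f v) + complex.Re (g v))).
    exact: measurable_funD.
  by apply/funext => v; case: (f v) => a b; case: (g v).
- rewrite (_ : (fun v => _) = (fun v => complex.Im (f v) + complex.Im (g v))).
    exact: measurable_funD.
  by apply/funext => v; case: (f v) => a b; case: (g v).
exists (K + L) => v Dv; rewrite rmorphD.
by apply: le_trans (ler_normD _ _) _; apply: lerD; [exact: fK|exact: gL].
Qed.

Lemma tame_cst c : tame (fun=> c).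
Proof.
split; [exact: measurable_cst|exact: measurable_cst|].
by have [x x0 cx] := ge0_complexE (normr_ge0 c); exists x => v _; rewrite cx.
Qed.

Lemma tame_sum (I : Type) (s : seq I) (f : I -> V -> C) :
  (forall i, tame (f i)) -> tame (fun v => \sum_(i <- s) f i v).
Proof.
move=> tf; elim: s => [|i s IHs].
  by rewrite (_ : (fun v => _) = (fun=> 0)); [exact: tame_cst|apply/funext => v; rewrite big_nil].
rewrite (_ : (fun v => _) = (fun v => f i v + \sum_(k <- s) f k v)).
  exact: tameD.
by apply/funext => v; rewrite big_cons.
Qed.

Lemma tame_bounded f : tame f ->
  [bounded complex.Re (f v) | v in D] /\ [bounded complex.Im (f v) | v in D].
Proof.
move=> [_ _ [K fK]]; split; exists K; split; rewrite ?num_real// => M KM v Dv /=.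
  by rewrite -lecR; apply: (le_trans (Re_norm_le _)); apply: (le_trans (fK v Dv)); rewrite lecR ltW.
by rewrite -lecR; apply: (le_trans (Im_norm_le _)); apply: (le_trans (fK v Dv)); rewrite lecR ltW.
Qed.

Variable mu : {measure set B -> \bar R}.
Hypotheses (mD : measurable (D : set B)) (Dfin : (mu (D : set B) < +oo)%E).

Lemma tame_integrable f : tame f ->
  mu.-integrable (D : set B) (EFin \o (fun v => complex.Re (f v))) /\
  mu.-integrable (D : set B) (EFin \o (fun v => complex.Im (f v))).
Proof.
move=> tf; have [bRe bIm] := tame_bounded tf; have [mRe mIm _] := tf.
by split; apply: measurable_bounded_integrable => //; exact: measurable_funTS.
Qed.

Lemma complex_integralD f g : tame f -> tame g ->
  complex_integral mu D (fun v => f v + g v) =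
  complex_integral mu D f + complex_integral mu D g.
Proof.
move=> /tame_integrable[fRe fIm] /tame_integrable[gRe gIm].
rewrite /complex_integral; apply/eqP; rewrite eq_complex /=; apply/andP; split; apply/eqP.
  rewrite -(RintegralD mD fRe gRe); congr (Rintegral _ _ _).
  by apply/funext => v; case: (f v) => a b; case: (g v).
rewrite -(RintegralD mD fIm gIm); congr (Rintegral _ _ _).
by apply/funext => v; case: (f v) => a b; case: (g v).
Qed.

Lemma complex_integralZ c f : tame f ->
  complex_integral mu D (fun v => c * f v) = c * complex_integral mu D f.
Proof.
move=> /tame_integrable[fRe fIm]; case: c => a b.
have iZ h k : mu.-integrable (D : set B) (EFin \o h) ->
    mu.-integrable (D : set B) (EFin \o (fun v => k * h v)).
  move=> hi; have := integrableZl mD k hi; congr (_.-integrable _ _).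
rewrite /complex_integral; apply/eqP; rewrite eq_complex /=; apply/andP; split; apply/eqP.
  rewrite -!RintegralZl// -RintegralB//; [|exact: iZ|exact: iZ].
  by congr (Rintegral _ _ _); apply/funext => v; case: (f v).
rewrite -!RintegralZl// -RintegralD//; [|exact: iZ|exact: iZ].
by congr (Rintegral _ _ _); apply/funext => v; case: (f v).
Qed.

Lemma complex_integral_conj f : tame f ->
  complex_integral mu D (fun v => Num.conj (f v)) = Num.conj (complex_integral mu D f).
Proof.
move=> /tame_integrable[fRe fIm].
rewrite /complex_integral; apply/eqP; rewrite eq_complex /=; apply/andP; split; apply/eqP.
  by congr (Rintegral _ _ _); apply/funext => v; case: (f v).
rewrite -mulN1r -RintegralZl//; congr (Rintegral _ _ _).
by apply/funext => v; rewrite mulN1r; case: (f v).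
Qed.

Lemma complex_integral_sum (I : Type) (s : seq I) (f : I -> V -> C) :
  (forall i, tame (f i)) ->
  complex_integral mu D (fun v => \sum_(i <- s) f i v) =
  \sum_(i <- s) complex_integral mu D (f i).
Proof.
move=> tf; elim: s => [|i s IHs].
  rewrite big_nil -[RHS](mul0r (complex_integral mu D (fun=> 0))).
  rewrite -complex_integralZ//; last exact: tame_cst.
  by congr (complex_integral _ _ _); apply/funext => v; rewrite big_nil mul0r.
rewrite big_cons -IHs -complex_integralD//; last exact: tame_sum.
by congr (complex_integral _ _ _); apply/funext => v; rewrite big_cons.
Qed.

End ComplexMean.

(** * The Hermitian form on linear functionals *)

Section Gram.
Variables (R : realType) (n : nat).
Local Notation C := R[i].
Local Notation V := 'rV[C]_n.
Local Notation B := (borel_space R n).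
Variables (mu : {measure set B -> \bar R}) (D : set V) (r : R).
Hypotheses (hmu : haar_measure mu) (oD : open D) (D0 : D 0).
Hypothesis Dr : D `<=` ball (0 : V) r%:C.

Let mD : measurable (D : set B). Proof. exact: open_borel. Qed.

Lemma haar_domain_fin : (mu (D : set B) < +oo)%E.
Proof. exact: (haar_bounded_fin hmu mD Dr). Qed.

Lemma haar_domain_gt0 : (0 < mu (D : set B))%E.
Proof. by have [_ _] := hmu; apply => //; exists 0. Qed.

Lemma fine_haar_domain_gt0 : 0 < fine (mu (D : set B)).
Proof. by rewrite fine_gt0// haar_domain_gt0 haar_domain_fin. Qed.

Definition gram (A A' : 'cV[C]_n) : C :=
  complex_integral mu D (fun v => colfun A v * Num.conj (colfun A' v)).

Lemma colfun_lin (a : C) (A A' : 'cV[C]_n) v :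
  colfun (a *: A + A') v = a * colfun A v + colfun A' v.
Proof. by rewrite /colfun mulmxDr -scalemxAr !mxE. Qed.

Lemma tame_gram (A A' : 'cV[C]_n) :
  tame D (fun v => colfun A v * Num.conj (colfun A' v)).
Proof. by apply: tameM; [|apply: tame_conj]; exact: tame_colfun Dr. Qed.

Lemma gram_lin a (A A' A'' : 'cV[C]_n) :
  gram (a *: A + A') A'' = a * gram A A'' + gram A' A''.
Proof.
have tA := tame_gram.
rewrite /gram -(complex_integralZ mD haar_domain_fin) // -(complex_integralD mD haar_domain_fin)//.
  congr (complex_integral _ _ _); apply/funext => v.
  by rewrite colfun_lin mulrDl mulrA.
by apply: tameM => //; exact: tame_cst.
Qed.

Lemma gramC (A A' : 'cV[C]_n) : gram A A' = Num.conj (gram A' A).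
Proof.
rewrite /gram -(complex_integral_conj mD haar_domain_fin); last exact: tame_gram.
congr (complex_integral _ _ _); apply/funext => v.
by rewrite rmorphM /= conjCK mulrC.
Qed.

Lemma gram_conjlin a (A A' A'' : 'cV[C]_n) :
  gram A'' (a *: A + A') = Num.conj a * gram A'' A + gram A'' A'.
Proof. by rewrite gramC gram_lin rmorphD rmorphM /= -!gramC. Qed.

Lemma gramZr a (A A' : 'cV[C]_n) : gram A (a *: A') = Num.conj a * gram A A'.
Proof.
have := gram_conjlin (a - 1) A' A' A.
by rewrite scalerBl scale1r subrK rmorphB rmorph1 mulrBl mul1r subrK.
Qed.

(** If the integral of |A(v)|^2 over [D] vanishes, then the open set of points
    of [D] where A does not vanish is null, hence empty, as Haar measure charges
    nonempty open sets.  So A vanishes on a neighbourhood of 0. *)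
Lemma gram_definite (A : 'cV[C]_n) : gram A A = 0 -> A = 0.
Proof.
pose s v := complex.Re (colfun A v * Num.conj (colfun A v)).
have sE v : (s v)%:C = `|colfun A v| ^+ 2.
  rewrite normCK /s; case: (colfun A v) => a b; apply/eqP; rewrite eq_complex /=.
  by simpc; rewrite mulrC addrC subrr !eqxx.
have s0 v : 0 <= s v by rewrite -lecR sE exprn_ge0.
have [si _] := tame_integrable mD haar_domain_fin (tame_gram A A).
move=> /(congr1 (@complex.Re R)) /= /eqP sint.
have {}sint : (\int[mu]_(v in (D : set B)) `|(s v)%:E| = 0)%E.
  rewrite (eq_integral (fun v : B => (s v)%:E)); last by move=> v _; rewrite abse_EFin ger0_norm.
  by apply/eqP; rewrite -fine_eq0 ?(integrable_fin_num mD si).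
have ms : measurable_fun (D : set B) (EFin \o s) := measurable_int mu si.
have [N [mN N0 sN]] := (ae_eq_integral_abs mu mD ms).1 sint.
have Az v : D v -> colfun A v = 0.
  move=> Dv; apply/eqP/negPn/negP => Av0.
  pose U := D `&` [set w | colfun A w != 0].
  have oU : open U.
    apply: openI => //.
    rewrite (_ : [set _ | _] = colfun A @^-1` (~` [set 0])).
      apply: open_comp => [w _|]; first exact: colfun_continuous.
      apply: closed_openC; apply: accessible_closed_set1.
      by apply: hausdorff_accessible; exact: norm_hausdorff.
    by apply/seteqP; split=> w /= /eqP.
  have [_ _ /(_ U oU)] := hmu.
  have -> : mu (U : set B) = 0%E.
    apply: (subset_measure0 _ mN) => //; first exact: open_borel.
    move=> w [Dw Aw]; apply: sN => /= /(_ Dw) [] /(congr1 (fun x => x%:C)).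
    by rewrite sE => /eqP; rewrite expf_eq0 /= normr_eq0 (negbTE Aw).
  by rewrite ltxx => /(_ (ex_intro _ v (conj Dv Av0))).
have /nbhs_ballP[e0 /= /gt0_complexE[e e_gt0 ->] eD] : nbhs (0 : V) D by exact: open_nbhs_nbhs.
apply/colP => i; rewrite mxE.
have e2 : 0 < e / 2 by rewrite divr_gt0.
pose v : V := (e / 2)%:C *: delta_mx 0 i.
have Dv : D v.
  apply: eD; apply/ball_rowP => [|k]; first by rewrite ltcR.
  rewrite !mxE sub0r normrN normrM norm_real_complex (gtr0_norm e2) normr_nat.
  apply: (@le_lt_trans _ _ (e / 2)%:C).
    apply: ler_piMr; first by rewrite lecR ltW.
    by rewrite lern1 leq_b1.
  by rewrite ltcR; lra.
have := Az v Dv; rewrite /colfun -scalemxAl mxE -rowE mxE => /eqP.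
rewrite mulf_eq0 => /orP[/eqP/complexI e20|/eqP//].
by rewrite e20 ltxx in e2.
Qed.

Lemma gram_riesz (k : R) (w : V) : k != 0 ->
  exists m : 'cV[C]_n, forall A, k%:C * gram A m = colfun A w.
Proof.
move=> k0; have kC0 : k%:C != 0 :> C by apply: contra k0 => /eqP/complexI ->.
pose f (s t : V) := k%:C * gram s^T t^T.
have f1 u a s t : f (a *: s + t) u = a * f s u + f t u.
  by rewrite /f linearP /= gram_lin mulrDr mulrCA.
have f2 u a s t : f u (a *: s + t) = Num.conj a * f u s + f u t.
  by rewrite /f linearP /= gram_conjlin mulrDr mulrCA.
have f3 s : f s s = 0 -> s = 0.
  move=> /eqP; rewrite mulf_eq0 (negbTE kC0) /= => /eqP/gram_definite.
  by move=> /(congr1 trmx); rewrite trmxK trmx0.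
have [d dE] := riesz_row f1 f2 f3 w; exists d^T => A.
have := dE A^T; rewrite /f trmxK => ->; rewrite /colfun mxE.
by apply: eq_bigr => i _; rewrite mxE mulrC.
Qed.

End Gram.

Section BinetLegendreGram.
Variables (R : realType) (n : nat).
Local Notation C := R[i].
Local Notation V := 'rV[C]_n.
Local Notation B := (borel_space R n).
Variables (mu : {measure set B -> \bar R}) (F : V -> R) (r : R).
Local Notation D := (unit_ball F).
Hypotheses (hmu : haar_measure mu) (oD : open D) (D0 : D 0).
Hypothesis Dr : D `<=` ball (0 : V) r%:C.

Definition binet_constant : R := n.+1%:R / fine (mu (D : set B)).

Lemma binet_constant_neq0 : binet_constant != 0.
Proof.
by rewrite mulf_neq0// invr_neq0// gt_eqF// (fine_haar_domain_gt0 hmu oD D0 Dr).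
Qed.

Definition functional_col (phi : 'Hom(V, C^o)) : 'cV[C]_n := \col_i phi (delta_mx 0 i).

Lemma functional_colE (phi : 'Hom(V, C^o)) (v : V) : phi v = colfun (functional_col phi) v.
Proof.
rewrite {1}(row_sum_delta v) linear_sum /colfun mxE; apply: eq_bigr => i _.
by rewrite linearZ mxE.
Qed.

Lemma colfun_functional (A : 'cV[C]_n) :
  exists phi : 'Hom(V, C^o), forall v : V, phi v = colfun A v.
Proof.
pose f (v : V) : C^o := colfun A v.
have fl : linear f by move=> a u v; rewrite /f /colfun mulmxDl -scalemxAl !mxE.
pose f' : {linear V -> C^o} := HB.pack f (GRing.isLinear.Build _ _ _ _ f fl).
by exists (linfun f') => v; rewrite lfunE.
Qed.

Lemma dual_binet_gram theta phi : dual_binet_legendre mu F theta phi =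
  binet_constant%:C * gram mu D (functional_col theta) (functional_col phi).
Proof.
congr (_ * complex_integral _ _ _); apply/funext => v.
by rewrite !functional_colE.
Qed.

(** The metric evaluates at [v] any representative [m] of [w].  The chosen
    representatives r_v and r_w satisfy g*(r_w, r_v) = r_w(v), which equals
    conj g*(r_v, r_w) = conj r_v(w) = conj g*(r_v, m) = g*(m, r_v) = m(v). *)
Lemma binet_legendreE (v w : V) (m : 'cV[C]_n) :
  (forall A, binet_constant%:C * gram mu D A m = colfun A w) ->
  binet_legendre mu F v w = colfun m v.
Proof.
move=> mE.
have dualC theta phi : dual_binet_legendre mu F theta phi =
    Num.conj (dual_binet_legendre mu F phi theta).
  rewrite !dual_binet_gram (gramC hmu oD Dr) [RHS]rmorphM; congr (_ * _).
  by apply/eqP; rewrite eq_complex /= oppr0 !eqxx.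
have rieszP u : forall phi, dual_binet_legendre mu F phi (binet_legendre_riesz mu F u) = phi u.
  have [d dE] := gram_riesz hmu oD D0 Dr u binet_constant_neq0.
  have [psi psiE] := colfun_functional d.
  suff : [set m | forall phi, dual_binet_legendre mu F phi m = phi u] psi by apply: xgetI.
  move=> phi; rewrite dual_binet_gram functional_colE -dE; congr (_ * gram _ _ _ _).
  by apply/colP => i; rewrite mxE psiE /colfun -rowE mxE.
have [psi psiE] := colfun_functional m.
have psi_col : functional_col psi = m.
  by apply/colP => i; rewrite mxE psiE /colfun -rowE mxE.
rewrite /binet_legendre -psiE -(rieszP v psi) dualC (rieszP w) dualC.
congr Num.conj; rewrite dual_binet_gram psi_col mE.
exact: functional_colE.
Qed.

End BinetLegendreGram.

(** * Product decomposition *)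

Section GramBox.
Variables (R : realType) (N : nat) (n : 'I_N -> nat).
Local Notation C := R[i].
Local Notation V := 'rV[C]_(\sum_j n j).
Local Notation B := (borel_space R (\sum_j n j)).
Variable mu : {measure set B -> \bar R}.
Variable nu : forall j, {measure set (borel_space R (n j)) -> \bar R}.
Hypotheses (hmu : haar_measure mu) (hnu : forall j, haar_measure (@nu j)).
Variables (D : forall j, set 'rV[C]_(n j)) (r : 'I_N -> R).
Hypotheses (oD : forall j, open (@D j)) (D0 : forall j, @D j 0).
Hypothesis Dr : forall j, @D j `<=` ball (0 : 'rV[C]_(n j)) (r j)%:C.
Hypothesis Dsym : forall j v, @D j v -> @D j (- v).

Let mD : forall j, measurable (@D j : set (borel_space R (n j))).
Proof. by move=> j; exact: open_borel. Qed.

Lemma box_open : open (box D).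
Proof.
rewrite openE => x Dx; have FF : Filter (nbhs x) by exact: nbhs_filter.
apply: (@filter_forall _ _ (fun j (z : V) => D (submxrow z j)) _ FF) => j.
apply: (@submxrow_continuous R N n j x); apply: open_nbhs_nbhs.
by split; [exact: oD|exact: Dx].
Qed.

Lemma box0 : box D 0.
Proof.
move=> j; rewrite (_ : submxrow 0 j = 0); first exact: D0.
by apply/rowP => i; rewrite !mxE.
Qed.

Definition box_radius : R := 1 + \sum_j `|r j|.

Lemma box_bounded : box D `<=` ball (0 : V) box_radius%:C.
Proof.
have R0 : 0 < box_radius by rewrite ltr_pwDl// sumr_ge0.
move=> x Dx; apply/(ball_blocks _ R0) => j.
apply: (@le_ball _ _ _ (r j)%:C); last exact/Dr/Dx.
rewrite lecR (le_trans (ler_norm (r j)))// /box_radius (bigD1 j)//= addrCA lerDl.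
by rewrite addr_ge0// sumr_ge0.
Qed.

Lemma complex_mean_box j (f : 'rV[C]_(n j) -> C) : tame (@D j) f ->
  ((fine (mu (box D : set B)))^-1)%:C *
    complex_integral mu (box D) (fun x => f (submxrow x j)) =
  ((fine (nu j (@D j : set (borel_space R (n j)))))^-1)%:C *
    complex_integral (nu j) (@D j) f.
Proof.
move=> tf; have [bRe bIm] := tame_bounded tf; have [mRe mIm _] := tf.
have box_gt0 := haar_domain_gt0 hmu box_open box0.
have := box_mean hmu mD Dr (@hnu j) box_gt0 mRe bRe.
have := box_mean hmu mD Dr (@hnu j) box_gt0 mIm bIm.
rewrite /complex_integral => eIm eRe; apply/eqP; rewrite eq_complex /= !mul0r !subr0 !addr0.
by apply/andP; split; apply/eqP; rewrite mulrC [RHS]mulrC.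
Qed.

Lemma complex_odd_box j (f : V -> C) : tame (box D) f ->
  (forall x, f (reflect_block j x) = - f x) -> complex_integral mu (box D) f = 0.
Proof.
move=> tf fodd; have [bRe bIm] := tame_bounded tf; have [mRe mIm _] := tf.
apply/eqP; rewrite eq_complex /=; apply/andP; split; apply/eqP.
  apply: (box_odd_integral hmu mD Dr (@Dsym j)) => // x; rewrite fodd.
  by case: (f x).
apply: (box_odd_integral hmu mD Dr (@Dsym j)) => // x; rewrite fodd.
by case: (f x).
Qed.

Lemma colfun_blocks (A : 'cV[C]_(\sum_j n j)) (x : V) :
  colfun A x = \sum_j colfun (submxcol A j) (submxrow x j).
Proof.
by rewrite /colfun -{1}[x]submxrowK -{1}[A]submxcolK mul_mxrow_mxcol summxE.
Qed.

(** Expanding both functionals over the blocks leaves the diagonal terms, which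
    are means over the factors; the cross terms are odd in one block. *)
Lemma gram_box (A A' : 'cV[C]_(\sum_j n j)) :
  ((fine (mu (box D : set B)))^-1)%:C * gram mu (box D) A A' =
  \sum_j ((fine (nu j (@D j : set (borel_space R (n j)))))^-1)%:C *
    gram (nu j) (@D j) (submxcol A j) (submxcol A' j).
Proof.
have mB : measurable (box D : set B) by apply: open_borel; exact: box_open.
have Bfin : (mu (box D : set B) < +oo)%E := haar_domain_fin hmu box_open box_bounded.
have tcol j (b : 'cV[C]_(n j)) : tame (box D) (fun x => colfun b (submxrow x j)).
  rewrite (_ : (fun x => _) = colfun (submxrow 1%:M j *m b)).
    exact: tame_colfun box_bounded.
  by apply/funext => x; rewrite /colfun mulmxA -submxrowE.
pose g j k x := colfun (submxcol A j) (submxrow x j) *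
  Num.conj (colfun (submxcol A' k) (submxrow x k)).
have tg j k : tame (box D) (g j k) by apply: tameM => //; exact: tame_conj.
have -> : gram mu (box D) A A' = \sum_j \sum_k complex_integral mu (box D) (g j k).
  transitivity (\sum_j complex_integral mu (box D) (fun x => \sum_k g j k x)).
    rewrite -(complex_integral_sum mB Bfin) => [|j]; last exact: tame_sum.
    congr (complex_integral _ _ _); apply/funext => x.
    rewrite colfun_blocks mulr_suml; apply: eq_bigr => j _.
    by rewrite colfun_blocks rmorph_sum mulr_sumr.
  by apply: eq_bigr => j _; rewrite (complex_integral_sum mB Bfin).
rewrite mulr_sumr; apply: eq_bigr => j _.
rewrite /gram -complex_mean_box//; last exact: tame_gram (@Dr j) _ _.
congr (_ * _); apply: (etrans (bigD1 j isT)) => /=.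
rewrite -[RHS]addr0; congr (_ + _); apply: big1 => k kj.
apply: (@complex_odd_box j) => // x; rewrite /g.
have -> : submxrow (reflect_block j x) j = - submxrow x j by rewrite mxrowK eqxx.
have -> : submxrow (reflect_block j x) k = submxrow x k by rewrite mxrowK (negbTE kj).
by rewrite /colfun mulNmx mxE mulNr.
Qed.

End GramBox.

Section Indicatrices.
Variables (R : realType) (n : nat) (M : complexManifold R n) (p : M).
Local Notation C := R[i].
Local Notation V := 'rV[C]_n.
Local Notation D := (unit_ball (@kobayashi_busemann R n M p) : set V).

Lemma busemann_ball_open : open D.
Proof.
have [e e0 eA] := indicatrix_ball p; rewrite unit_ball_busemann.
exact: gauge_ball_open e0 eA.
Qed.

Lemma busemann_ball0 : D 0.
Proof.
have [e e0 eA] := indicatrix_ball p; rewrite unit_ball_busemann.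
exact: gauge_ball0 e0 eA.
Qed.

Lemma busemann_ball_sym v : D v -> D (- v).
Proof. by rewrite unit_ball_busemann; apply: gauge_ball_sym; exact: indicatrix_sym. Qed.

Lemma busemann_ball_bounded : kobayashi_hyperbolic M ->
  exists r : R, D `<=` ball (0 : V) r%:C.
Proof.
move=> /(indicatrix_bounded p)[r r0 Ar]; exists r; rewrite unit_ball_busemann.
exact: gauge_ball_bounded.
Qed.

End Indicatrices.

Lemma busemann_ball_prod (R : realType) (N : nat) (n : 'I_N -> nat)
    (M : forall j, complexManifold R (n j)) (p : prod_manifold M) :
  (unit_ball (@kobayashi_busemann R _ (prod_manifold M) p) : set 'rV[R[i]]_(\sum_j n j)) =
  box (fun j => unit_ball (@kobayashi_busemann R (n j) (M j) (prod_proj p j))).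
Proof.
have /(_ _)/cid2 - /all_sig2[e e0 eA] := fun j => indicatrix_ball (prod_proj p j).
have {1}-> := unit_ball_busemann p.
transitivity (box (fun j => gauge_ball (@kobayashi_indicatrix R (n j) (M j) (prod_proj p j)))).
  rewrite -(gauge_ball_box e0 eA); congr gauge_ball.
  by apply/seteqP; split=> u; [move=> /kobayashi_prod_lt1|move=> /kobayashi_prod_lt1].
congr box; apply: functional_extensionality_dep => j.
by rewrite unit_ball_busemann.
Qed.

Local Close Scope classical_set_scope.
Local Close Scope complex_scope.

Theorem theorem1p2 (R : realType) (N : nat) (n : 'I_N -> nat)
    (M : forall j : 'I_N, complexManifold R (n j))
    (hN : (0 < N)%N) (hn : forall j : 'I_N, (0 < n j)%N)
    (hM : forall j : 'I_N, kobayashi_hyperbolic (M j))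
    (mu : {measure set (borel_space R (\sum_(j < N) n j)) -> \bar R})
    (nu : forall j : 'I_N, {measure set (borel_space R (n j)) -> \bar R})
    (hmu : haar_measure mu) (hnu : forall j : 'I_N, haar_measure (nu j))
    (p : prod_manifold M) (v w : tangent_space p) :
  kappa mu v w =
  \sum_(j < N) ((n j).+1%:R / (\sum_(k < N) n k).+1%:R) *
    kappa (nu j) (tangent_proj v j) (tangent_proj w j).
Proof.
pose F j := @kobayashi_busemann R (n j) (M j) (prod_proj p j).
pose D j : set 'rV[R[i]]_(n j) := unit_ball (F j).
have oD j : open (D j) := @busemann_ball_open R (n j) (M j) (prod_proj p j).
have D0 j : D j 0 := @busemann_ball0 R (n j) (M j) (prod_proj p j).
have Dsym j u : D j u -> D j (- u) := @busemann_ball_sym _ _ _ (prod_proj p j) u.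
have /(_ _)/cid - /all_sig[r Dr] := fun j => busemann_ball_bounded (prod_proj p j) (hM j).
have DE := busemann_ball_prod p.
have oB : open (unit_ball (@kobayashi_busemann R _ (prod_manifold M) p)).
  by rewrite DE; exact: box_open oD.
have /(_ _)/cid - /all_sig[m mE] := fun j =>
  gram_riesz (hnu j) (oD j) (D0 j) (Dr j) (tangent_proj w j)
    (binet_constant_neq0 (hnu j) (oD j) (D0 j) (Dr j)).
(* The representatives of the factors, weighted, form a representative for the
   product: the weights undo the factors (n + 1) / (n_j + 1) of the dual form. *)
pose q j : R := (n j).+1%:R / (\sum_k n k).+1%:R.
pose m' : 'cV[R[i]]_(\sum_j n j) := \mxcol_j ((real_complex R (q j)) *: m j).
have kappaE j : kappa (nu j) (tangent_proj v j) (tangent_proj w j) =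
    colfun (m j) (tangent_proj v j).
  exact: binet_legendreE (hnu j) (oD j) (D0 j) (Dr j) _ _ _ (mE j).
have S0 : (\sum_k n k).+1%:R != 0 :> R by rewrite pnatr_eq0.
have conjR (x : R) : Num.conj (real_complex R x) = real_complex R x.
  by apply/eqP; rewrite eq_complex /= oppr0 !eqxx.
transitivity (colfun m' v); last first.
  rewrite colfun_blocks; apply: eq_bigr => j _; rewrite kappaE mxcolK.
  by rewrite /colfun -scalemxAr mxE /q fmorph_div !rmorph_nat.
apply: (@binet_legendreE _ _ mu _ (box_radius r) hmu oB).
- by rewrite DE; exact: box0 D0.
- by rewrite DE; exact: box_bounded Dr.
move=> A; rewrite /binet_constant DE [real_complex R _]rmorphM -mulrA.
rewrite (gram_box hmu hnu oD D0 Dr Dsym).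
rewrite mulr_sumr colfun_blocks; apply: eq_bigr => j _; rewrite mxcolK.
rewrite (gramZr (hnu j) (oD j) (Dr j)) conjR -mE /binet_constant mulrCA !mulrA -!rmorphM.
congr (real_complex R _ * _).
by rewrite /q -mulrA [_ * (_ / _)]mulrC divfK // mulrC.
Qed.
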